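(* Let $d\sigma$ and $d\sigma_h$ denote the three-dimensional surface measures of $S$ and $S_h$, respectively. For $1\le n\le N$ let $\mu_h^S$ be the function on $S_h^n$ such that $\mu_h^S\,d\sigma_h=d\sigma\circ\mathbf p$ on $S_h^n$, and let $\mathbf n_0^T:=(\mathbf n^T,0)$. Then $$\mu_h^S=\alpha^e\;\mathbf n_0\cdot\mathbf n_{S_h}\prod_{i=1}^2(1-\delta\,\kappa_i)\qquad\text{on }S_h^n .$$
   Context: Continuous surface. $\Omega\subset\mathbb R^3$ is a domain, $T>0$, $\mathbf w:\Omega\times[0,T]\to\mathbb R^3$ a smooth velocity field, $\phi:\Omega\times[0,T]\to\mathbb R$ solves $\partial_t\phi+\mathbf w\cdot\nabla\phi=0$, and $\Gamma(t)=\{x\in\Omega:\phi(x,t)=0\}$ is a closed connected orientable $C^2$-hypersurface for all $t\in[0,T]$. $S=\bigcup_{t\in[0,T]}\Gamma(t)\times\{t\}\subset\mathbb R^4$. In a neighborhood $U=\bigcup_tU(t)\times\{t\}$ of $S$, $\|\nabla\phi\|$ is bounded above and below by positive constants and $D^2\phi,\partial_t\phi,\partial_t\nabla\phi$ are bounded. On $S$: $\mathbf n=\nabla\phi/\|\nabla\phi\|$, $V=\mathbf w\cdot\mathbf n$, $\alpha=\sqrt{1+V^2}$. Projection and extension. $\delta(\cdot,t)$ is the spatial signed distance to $\Gamma(t)$ (sufficiently smooth on $U$, same sign as $\phi$), $\mathbf n=\nabla\delta$ on $U$, $\mathbf p:U\to S$, $\mathbf p(x,t)=(x-\delta(x,t)\mathbf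 n(x,t),t)$. For $v$ on $S$: $v^e=v\circ\mathbf p$ on $U$. $\kappa_1,\kappa_2,0$ are the eigenvalues of the Weingarten map $\mathbf H=D\mathbf n$ (spatial Jacobian) on $U(t)$; so on $U(t)$, $\kappa_i=\kappa_i^e/(1+\delta\kappa_i^e)$ with $\kappa_i^e$ the extended principal curvature of $\Gamma(t)$. Discrete surface. $0=t_0<\dots<t_N=T$, $I_n=[t_{n-1},t_n]$, $Q_n=\Omega\times I_n$, $S^n=S\cap Q_n$. $\mathcal T$ is a shape regular tetrahedral triangulation of $\Omega$, $V_h^m$ the continuous piecewise polynomials of degree $\le m$; $V_h^{m_s,m_q}$ the functions $v$ on $\Omega\times[0,T]$ with $v|_{Q_n}=\sum_{i=0}^{m_q}t^iv_i(x)$, $v_i\in V_h^{m_s}$. $\phi_h\in V_h^{k_{g,s},k_{g,q}}$ approximates $\phi$, $\hat\phi_h(\cdot,t)$ is its spatial piecewise linear nodal interpolant, $S^n_{\rm lin}=\{(x,t)\in Q_n:\hat\phi_h(x,t)=0\}$. $Q_n^S\subset U$ is the union of prisms $K\times I_n$ over the $K\in\mathcal T$ cut by the zero level of $\hat\phi_h(\cdot,t)$ (positive two-dimensional measure) for some $t\in I_n$. $\Theta_h^n(x,t)=(\Theta^n_{h,s}(x,t),t)$, $\Theta^n_{h,s}\in(V_h^{k_{g,s},k_{g,q}})^3$, is a mesh deformation on $Q_n^S$ that is a homeomorphism onto its image, close to the identity. $S_h^n=\Theta_h^n(S^n_{\rm lin})$, $S_h=\bigcup_nS_h^n$ is the (piecewise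 smooth, Lipschitz) space-time surface approximation. $\mathbf n_{S_h}\in\mathbb R^4$ is its unit normal, defined a.e. by $\mathbf n_{S_h}\circ\Theta_h^n=(D_{(x,t)}\Theta_h^n)^{-T}\mathbf n_{S_{\rm lin}}/\|(D_{(x,t)}\Theta_h^n)^{-T}\mathbf n_{S_{\rm lin}}\|$ with $\mathbf n_{S_{\rm lin}}=\nabla_{(x,t)}\hat\phi_h/\|\nabla_{(x,t)}\hat\phi_h\|$. $h$ and $\Delta t$ are so small that $S_h^n\subset U$, $\mathbf p|_{S_h^n}:S_h^n\to S^n$ is bijective, $\mathbf n_0\cdot\mathbf n_{S_h}>0$ and $1-\delta\kappa_i>0$ on $S_h^n$. *)

(* Defs.v *)
From HB Require Import structures.
From mathcomp Require Import all_boot all_order all_algebra.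
From mathcomp Require Import all_classical all_reals all_analysis.

Set Implicit Arguments.
Unset Strict Implicit.
Unset Printing Implicit Defensive.

Import Order.TTheory GRing.Theory Num.Theory.
Import numFieldNormedType.Exports.

Local Open Scope classical_set_scope.
Local Open Scope ring_scope.

(* Vectors are row vectors.  The library norm of ['rV[R]_n] is the sup norm:
   it is only used through the topology it induces, lengths are [enorm]. *)

Definition dot (R : realType) n (u v : 'rV[R]_n) : R :=
  \sum_(i < n) u 0 i * v 0 i.

Definition enorm (R : realType) n (u : 'rV[R]_n) : R := Num.sqrt (dot u u).

Definition normalize (R : realType) n (u : 'rV[R]_n) : 'rV[R]_n :=
  (enorm u)^-1 *: u.

(* [st x t] is the space-time point (x, t) of R^3 x R = R^4. *)
Definition st (R : realType) (x : 'rV[R]_3) (t : R) : 'rV[R]_4 :=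
  row_mx x (t%:M : 'M[R]_1).

Definition sp (R : realType) (z : 'rV[R]_4) : 'rV[R]_3 :=
  lsubmx (z : 'rV[R]_(3 + 1)).

Definition tm (R : realType) (z : 'rV[R]_4) : R := z 0 ord_max.

Definition cylinder (R : realType) (A : set 'rV[R]_3) (I : set R) :
    set 'rV[R]_4 :=
  [set z | A (sp z) /\ I (tm z)].

Fixpoint Ck (R : realType) n (V : normedModType R) (k : nat)
    (O : set 'rV[R]_n) (f : 'rV[R]_n -> V) : Prop :=
  match k with
  | 0%N => forall x, O x -> {for x, continuous f}
  | k'.+1 => (forall x, O x -> differentiable f x) /\
             forall v : 'rV[R]_n, Ck k' O (fun x => 'D_v f x)
  end.

(* Functions are total: what is prescribed on a set [A] that is not open
   (for instance up to the times 0 and T) is that the total function is of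
   class C^k on some open set containing [A]. *)
Definition Ck_on (R : realType) n (V : normedModType R) (k : nat)
    (A : set 'rV[R]_n) (f : 'rV[R]_n -> V) : Prop :=
  exists O : set 'rV[R]_n, [/\ open O, A `<=` O & Ck k O f].

Definition smooth_on (R : realType) n (V : normedModType R)
    (A : set 'rV[R]_n) (f : 'rV[R]_n -> V) : Prop :=
  exists O : set 'rV[R]_n, [/\ open O, A `<=` O & forall k, Ck k O f].

Definition grad (R : realType) n (f : 'rV[R]_n -> R) (x : 'rV[R]_n) :
    'rV[R]_n :=
  \row_(j < n) 'D_(delta_mx 0 j) f x.

Definition sgrad (R : realType) (f : 'rV[R]_4 -> R) (z : 'rV[R]_4) :
    'rV[R]_3 :=
  sp (grad f z).

Definition dt (R : realType) (V : normedModType R) (f : 'rV[R]_4 -> V)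
    (z : 'rV[R]_4) : V :=
  'D_(st 0 1) f z.

Definition sjac (R : realType) (f : 'rV[R]_4 -> 'rV[R]_3) (z : 'rV[R]_4) :
    'M[R]_3 :=
  \matrix_(i < 3, j < 3) ('D_(st (delta_mx 0 j) 0) f z) 0 i.

Definition local_equation (R : realType) n (M : set 'rV[R]_n) (x : 'rV[R]_n)
    (f : 'rV[R]_n -> R) : Prop :=
  exists W : set 'rV[R]_n,
    [/\ open W, W x, Ck 2 W f, forall y, W y -> grad f y != 0
      & M `&` W = [set y | f y = 0] `&` W].

Definition C2_hypersurface (R : realType) n (M : set 'rV[R]_n) : Prop :=
  forall x, M x -> exists f, local_equation M x f.

Definition orientable (R : realType) n (M : set 'rV[R]_n) : Prop :=
  exists nu : 'rV[R]_n -> 'rV[R]_n,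
    {within M, continuous nu} /\
    forall x, M x -> enorm (nu x) = 1 /\
      forall f, local_equation M x f -> exists c : R, nu x = c *: grad f x.

Notation borel4 R := (g_sigma_algebraType (@open 'rV[R]_4)).

Notation leb2 R := (@lebesgue_measure R \x @lebesgue_measure R)%E.
Notation leb3 R := (leb2 R \x @lebesgue_measure R)%E.

Definition vec3 (R : realType) (y : R * R * R) : 'rV[R]_3 :=
  \row_(i < 3) nth 0 [:: y.1.1; y.1.2; y.2] i.

Definition gram (R : realType) (X : 'rV[R]_3 -> 'rV[R]_4) (y : 'rV[R]_3) : R :=
  Num.sqrt (\det ('J X y *m ('J X y)^T)).

Definition parametrization (R : realType) (M : set 'rV[R]_4)
    (O : set 'rV[R]_3) (X : 'rV[R]_3 -> 'rV[R]_4) : Prop :=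
  [/\ open O, Ck 1 O X, {in O &, injective X} & X @` O `<=` M].

(* The three-dimensional surface measure of [M], i.e. the restriction to [M]
   of the three-dimensional Hausdorff measure: d sigma = sqrt (det G) dy in
   every C^1 parametrization of a part of [M], G being the Gram matrix (points
   where G is singular contribute nothing, so that parametrizations need not
   be immersions); two-dimensional sets are null.  When [M] is
   [piecewise_smooth], these conditions determine the measure. *)
Record surface_measure (R : realType) (M : set 'rV[R]_4)
    (sigma : {measure set (borel4 R) -> \bar R}) : Prop := {
  surface_measure_param :
    forall (O : set 'rV[R]_3) (X : 'rV[R]_3 -> 'rV[R]_4),
      parametrization M O X ->
      forall B : set (measurableTypeR R * measurableTypeR R
                      * measurableTypeR R),
        measurable B -> (forall y, B y -> O (vec3 y)) ->
        sigma ((fun y => X (vec3 y)) @` B) =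
        (\int[leb3 R]_(y in B) (gram X (vec3 y))%:E)%E ;
  surface_measure_lower_dim :
    forall (D : set 'rV[R]_2) (Z : 'rV[R]_2 -> 'rV[R]_4),
      open D -> Ck 1 D Z -> sigma (Z @` D) = 0%E ;
  surface_measure_support : sigma (~` M) = 0%E }.

(* Up to two-dimensional sets, [M] is covered by countably many regular
   C^1 patches. *)
Definition piecewise_smooth (R : realType) (M : set 'rV[R]_4) : Prop :=
  exists (O : nat -> set 'rV[R]_3) (X : nat -> 'rV[R]_3 -> 'rV[R]_4)
         (D : nat -> set 'rV[R]_2) (Z : nat -> 'rV[R]_2 -> 'rV[R]_4),
    [/\ forall k, parametrization M (O k) (X k),
        forall k y, O k y -> 0 < gram (X k) y,
        forall k, open (D k) /\ Ck 1 (D k) (Z k)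
      & M `<=` (\bigcup_k (X k @` O k)) `|` (\bigcup_k (Z k @` D k))].

Definition Gamma (R : realType) (Omega : set 'rV[R]_3)
    (phi : 'rV[R]_4 -> R) (t : R) : set 'rV[R]_3 :=
  [set x | Omega x /\ phi (st x t) = 0].

Definition surfS (R : realType) (Omega : set 'rV[R]_3) (T : R)
    (phi : 'rV[R]_4 -> R) : set 'rV[R]_4 :=
  [set z | `[0, T]%classic (tm z) /\ Gamma Omega phi (tm z) (sp z)].

Record evolving_surface (R : realType) (Omega : set 'rV[R]_3) (T : R)
    (w : 'rV[R]_4 -> 'rV[R]_3) (phi : 'rV[R]_4 -> R) : Prop := {
  domain_open : open Omega ;
  domain_connected : connected Omega ;
  domain_nonempty : Omega !=set0 ;
  final_time_gt0 : 0 < T ;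
  velocity_smooth : smooth_on (cylinder Omega `[0, T]) w ;
  level_set_C1 : Ck_on 1 (cylinder Omega `[0, T]) phi ;
  transport : forall z, cylinder Omega `[0, T] z ->
    dt phi z + dot (w z) (sgrad phi z) = 0 ;
  Gamma_surface : forall t, `[0, T]%classic t ->
    [/\ Gamma Omega phi t !=set0, compact (Gamma Omega phi t),
        connected (Gamma Omega phi t), C2_hypersurface (Gamma Omega phi t)
      & orientable (Gamma Omega phi t)] }.

(* [U] is a relatively open subset of Omega x [0, T]. *)
Record surface_neighborhood (R : realType) (Omega : set 'rV[R]_3) (T : R)
    (phi : 'rV[R]_4 -> R) (U : set 'rV[R]_4) : Prop := {
  neighborhood_open : exists O : set 'rV[R]_4,
    open O /\ U = cylinder Omega `[0, T] `&` O ;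
  neighborhood_sub : surfS Omega T phi `<=` U ;
  level_set_grad_C1 : Ck_on 1 U (sgrad phi) ;
  level_set_bounds : exists c C : R, 0 < c /\
    forall z, U z ->
      [/\ c <= enorm (sgrad phi z) <= C, `|sjac (sgrad phi) z| <= C,
          `|dt phi z| <= C & `|dt (sgrad phi) z| <= C] }.

Definition normal_on_S (R : realType) (phi : 'rV[R]_4 -> R) (z : 'rV[R]_4) :
    'rV[R]_3 :=
  normalize (sgrad phi z).

Definition normal_velocity (R : realType) (w : 'rV[R]_4 -> 'rV[R]_3)
    (phi : 'rV[R]_4 -> R) (z : 'rV[R]_4) : R :=
  dot (w z) (normal_on_S phi z).

Definition alpha (R : realType) (w : 'rV[R]_4 -> 'rV[R]_3)
    (phi : 'rV[R]_4 -> R) (z : 'rV[R]_4) : R :=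
  Num.sqrt (1 + normal_velocity w phi z ^+ 2).

Definition signed_distance (R : realType) (Omega : set 'rV[R]_3)
    (phi : 'rV[R]_4 -> R) (z : 'rV[R]_4) : R :=
  Num.sg (phi z) *
  inf [set enorm (sp z - y) | y in Gamma Omega phi (tm z)].

Definition nrm (R : realType) (delta : 'rV[R]_4 -> R) : 'rV[R]_4 -> 'rV[R]_3 :=
  sgrad delta.

Definition nrm0 (R : realType) (delta : 'rV[R]_4 -> R) (z : 'rV[R]_4) :
    'rV[R]_4 :=
  st (nrm delta z) 0.

Definition closest (R : realType) (delta : 'rV[R]_4 -> R) (z : 'rV[R]_4) :
    'rV[R]_4 :=
  st (sp z - delta z *: nrm delta z) (tm z).

Definition extension (R : realType) (delta : 'rV[R]_4 -> R)
    (v : 'rV[R]_4 -> R) : 'rV[R]_4 -> R :=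
  v \o closest delta.

Record projection_setting (R : realType) (Omega : set 'rV[R]_3) (T : R)
    (phi : 'rV[R]_4 -> R) (U : set 'rV[R]_4) (delta : 'rV[R]_4 -> R)
    (kappa : 'I_2 -> 'rV[R]_4 -> R) : Prop := {
  delta_def : forall z, U z -> delta z = signed_distance Omega phi z ;
  delta_smooth : Ck_on 2 U delta ;
  proj_to_S : forall z, U z -> surfS Omega T phi (closest delta z) ;
  kappa_eigenvalues : forall z, U z ->
    char_poly (sjac (nrm delta) z) =
    'X * \prod_(i < 2) ('X - (kappa i z)%:P) }.

(* A tetrahedron is given by the set of its four vertices,
   a vertex being an index into the family [node]. *)

Definition simplex (R : realType) m (node : 'I_m -> 'rV[R]_3)
    (K : {set 'I_m}) : set 'rV[R]_3 :=
  [set x | exists l : 'I_m -> R,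
    [/\ forall i, 0 <= l i, forall i, i \notin K -> l i = 0,
        \sum_i l i = 1 & x = \sum_i l i *: node i]].

Definition affinely_independent (R : realType) m (node : 'I_m -> 'rV[R]_3)
    (K : {set 'I_m}) : Prop :=
  forall c : 'I_m -> R, (forall i, i \notin K -> c i = 0) ->
    \sum_i c i = 0 -> \sum_i c i *: node i = 0 -> forall i, c i = 0.

Record triangulation (R : realType) (Omega : set 'rV[R]_3) m
    (node : 'I_m -> 'rV[R]_3) (mesh : {set {set 'I_m}}) (creg : R) :
    Prop := {
  mesh_tetrahedra : forall K, K \in mesh ->
    #|K| = 4%N /\ affinely_independent node K ;
  mesh_conforming : forall K L, K \in mesh -> L \in mesh ->
    simplex node K `&` simplex node L = simplex node (K :&: L) ;
  mesh_cover : closure Omega =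
    [set x | exists2 K, K \in mesh & simplex node K x] ;
  mesh_shape_regular : forall K, K \in mesh ->
    exists (b : 'rV[R]_3) (r : R),
      [/\ 0 < r, forall x, enorm (x - b) <= r -> simplex node K x
        & forall x y, simplex node K x -> simplex node K y ->
            enorm (x - y) <= creg * r] }.

Definition polynomial_fun (R : realType) (d : nat) (f : 'rV[R]_3 -> R) :
    Prop :=
  exists c : {ffun 'I_3 -> 'I_d.+1} -> R, forall x,
    f x = \sum_(a : {ffun 'I_3 -> 'I_d.+1} | (\sum_i a i <= d)%N)
            c a * \prod_i x 0 i ^+ a i.

Definition fe_space (R : realType) (Omega : set 'rV[R]_3) m
    (node : 'I_m -> 'rV[R]_3) (mesh : {set {set 'I_m}}) (d : nat)
    (v : 'rV[R]_3 -> R) : Prop :=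
  {within closure Omega, continuous v} /\
  forall K, K \in mesh -> exists2 q, polynomial_fun d q &
    forall x, simplex node K x -> v x = q x.

Definition time_partition (R : realType) (T : R) (N : nat) (tk : nat -> R) :
    Prop :=
  [/\ tk 0%N = 0, tk N = T & forall n, (n < N)%N -> tk n < tk n.+1].

Definition slab (R : realType) (tk : nat -> R) (n : nat) : set R :=
  `[tk n.-1, tk n].

Definition st_fe_space (R : realType) (Omega : set 'rV[R]_3) m
    (node : 'I_m -> 'rV[R]_3) (mesh : {set {set 'I_m}})
    (N : nat) (tk : nat -> R) (ds dq : nat) (v : 'rV[R]_4 -> R) : Prop :=
  forall n, (1 <= n <= N)%N -> exists u : 'I_dq.+1 -> 'rV[R]_3 -> R,
    (forall i, fe_space Omega node mesh ds (u i)) /\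
    forall x t, closure Omega x -> slab tk n t ->
      v (st x t) = \sum_(i < dq.+1) t ^+ i * u i x.

Definition nodal_interpolant (R : realType) (Omega : set 'rV[R]_3) (T : R) m
    (node : 'I_m -> 'rV[R]_3) (mesh : {set {set 'I_m}})
    (phih phil : 'rV[R]_4 -> R) : Prop :=
  forall t, `[0, T]%classic t ->
    fe_space Omega node mesh 1 (fun x => phil (st x t)) /\
    forall K i, K \in mesh -> i \in K ->
      phil (st (node i) t) = phih (st (node i) t).

Definition Slin (R : realType) (Omega : set 'rV[R]_3) (tk : nat -> R)
    (phil : 'rV[R]_4 -> R) (n : nat) : set 'rV[R]_4 :=
  [set z | cylinder Omega (slab tk n) z /\ phil z = 0].

(* Some plane meets [A] in a set of positive area; for a subset of a plane
   this says that its two-dimensional measure is positive. *)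
Definition positive_area (R : realType) (A : set 'rV[R]_3) : Prop :=
  exists o e f : 'rV[R]_3,
    [/\ dot e e = 1, dot f f = 1, dot e f = 0
      & (0 < leb2 R [set ab : R * R | A (o + ab.1 *: e + ab.2 *: f)%R])%E].

Definition cut_element (R : realType) m (node : 'I_m -> 'rV[R]_3)
    (mesh : {set {set 'I_m}}) (tk : nat -> R) (phil : 'rV[R]_4 -> R)
    (n : nat) (K : {set 'I_m}) : Prop :=
  K \in mesh /\ exists2 t, slab tk n t &
    positive_area [set x | simplex node K x /\ phil (st x t) = 0].

Definition QS (R : realType) m (node : 'I_m -> 'rV[R]_3)
    (mesh : {set {set 'I_m}}) (tk : nat -> R) (phil : 'rV[R]_4 -> R)
    (n : nat) : set 'rV[R]_4 :=
  [set z | exists2 K, cut_element node mesh tk phil n K &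
                      cylinder (simplex node K) (slab tk n) z].

Definition homeomorphism_onto_image (R : realType) n (A : set 'rV[R]_n)
    (f : 'rV[R]_n -> 'rV[R]_n) : Prop :=
  {within A, continuous f} /\
  exists2 g : 'rV[R]_n -> 'rV[R]_n,
    {within f @` A, continuous g} & forall x, A x -> g (f x) = x.

Definition mesh_deformation (R : realType) (Omega : set 'rV[R]_3) m
    (node : 'I_m -> 'rV[R]_3) (mesh : {set {set 'I_m}})
    (N : nat) (tk : nat -> R) (ds dq : nat) (A : set 'rV[R]_4)
    (Theta : 'rV[R]_4 -> 'rV[R]_4) : Prop :=
  [/\ forall z, A z -> tm (Theta z) = tm z,
      forall i : 'I_3, exists2 v,
        st_fe_space Omega node mesh N tk ds dq v &
        forall z, A z -> sp (Theta z) 0 i = v z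
    & homeomorphism_onto_image A Theta].

(* [Theta] is only meaningful on [QS]. *)
Definition Sh_slab (R : realType) (Omega : set 'rV[R]_3) m
    (node : 'I_m -> 'rV[R]_3) (mesh : {set {set 'I_m}}) (tk : nat -> R)
    (phil : 'rV[R]_4 -> R) (Theta : nat -> 'rV[R]_4 -> 'rV[R]_4) (n : nat) :
    set 'rV[R]_4 :=
  Theta n @` (Slin Omega tk phil n `&` QS node mesh tk phil n).

Definition Sh (R : realType) (Omega : set 'rV[R]_3) m
    (node : 'I_m -> 'rV[R]_3) (mesh : {set {set 'I_m}}) (N : nat)
    (tk : nat -> R) (phil : 'rV[R]_4 -> R)
    (Theta : nat -> 'rV[R]_4 -> 'rV[R]_4) : set 'rV[R]_4 :=
  [set z | exists2 n, (1 <= n <= N)%N &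
                      Sh_slab Omega node mesh tk phil Theta n z].

Record discrete_surface (R : realType) (Omega : set 'rV[R]_3) (T : R)
    (U : set 'rV[R]_4) m (node : 'I_m -> 'rV[R]_3)
    (mesh : {set {set 'I_m}}) (creg : R) (N : nat) (tk : nat -> R)
    (kgs kgq : nat) (phih phil : 'rV[R]_4 -> R)
    (Theta : nat -> 'rV[R]_4 -> 'rV[R]_4) : Prop := {
  ds_mesh : triangulation Omega node mesh creg ;
  ds_time : time_partition T N tk ;
  ds_phih : st_fe_space Omega node mesh N tk kgs kgq phih ;
  ds_phil : nodal_interpolant Omega T node mesh phih phil ;
  ds_QS : forall n, (1 <= n <= N)%N -> QS node mesh tk phil n `<=` U ;
  ds_Theta : forall n, (1 <= n <= N)%N ->
    mesh_deformation Omega node mesh N tk kgs kgq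
      (QS node mesh tk phil n) (Theta n) ;
  ds_piecewise_smooth : forall n, (1 <= n <= N)%N ->
    piecewise_smooth (Sh_slab Omega node mesh tk phil Theta n) }.

(* [g] extends [f] from the space-time prism [A] to a map differentiable
   at [z]; if [z] lies on the boundary of [A], the derivative of [g] at [z]
   is the one-sided derivative of [f] from within [A]. *)
Definition prism_extension (R : realType) (V : normedModType R)
    (A : set 'rV[R]_4) (f : 'rV[R]_4 -> V) (z : 'rV[R]_4)
    (g : 'rV[R]_4 -> V) : Prop :=
  differentiable g z /\ forall y, A y -> g y = f y.

(* Almost everywhere on [Sh_slab], [nh] is given by the formula for the unit
   normal, the derivatives of Theta and of the piecewise linear level set
   function being taken in one of the prisms that contain the point.  Since
   ['J g z] acts on row vectors from the right, the Jacobian matrix acting on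
   columns is its transpose, and the row vector of the inverse transpose
   Jacobian applied to u is u *m (invmx ('J g z))^T. *)
Definition discrete_normal (R : realType) (Omega : set 'rV[R]_3) m
    (node : 'I_m -> 'rV[R]_3) (mesh : {set {set 'I_m}}) (tk : nat -> R)
    (phil : 'rV[R]_4 -> R) (Theta : nat -> 'rV[R]_4 -> 'rV[R]_4)
    (sigmah : {measure set (borel4 R) -> \bar R})
    (nh : 'rV[R]_4 -> 'rV[R]_4) (n : nat) : Prop :=
  {ae sigmah, forall z : borel4 R,
    Sh_slab Omega node mesh tk phil Theta n z ->
    exists (K : {set 'I_m}) (y : 'rV[R]_4) (q : 'rV[R]_4 -> R)
           (theta : 'rV[R]_4 -> 'rV[R]_4),
      let prism := cylinder (simplex node K) (slab tk n) in
      let nlin := normalize (grad q y) in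
      [/\ cut_element node mesh tk phil n K,
          prism y /\ Slin Omega tk phil n y,
          Theta n y = z,
          prism_extension prism phil y q /\
          prism_extension prism (Theta n) y theta
        & [/\ grad q y != 0, 'J theta y \in unitmx
            & nh z = normalize (nlin *m (invmx ('J theta y))^T)]]}.

Record resolved (R : realType) (Omega : set 'rV[R]_3) (T : R)
    (phi : 'rV[R]_4 -> R) (U : set 'rV[R]_4) (delta : 'rV[R]_4 -> R)
    (kappa : 'I_2 -> 'rV[R]_4 -> R) m
    (node : 'I_m -> 'rV[R]_3) (mesh : {set {set 'I_m}}) (tk : nat -> R)
    (phil : 'rV[R]_4 -> R) (Theta : nat -> 'rV[R]_4 -> 'rV[R]_4)
    (sigmah : {measure set (borel4 R) -> \bar R})
    (nh : 'rV[R]_4 -> 'rV[R]_4) (n : nat) : Prop := {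
  resolved_sub : Sh_slab Omega node mesh tk phil Theta n `<=` U ;
  resolved_bij : set_bij (Sh_slab Omega node mesh tk phil Theta n)
    (surfS Omega T phi `&` cylinder Omega (slab tk n)) (closest delta) ;
  resolved_normal : {ae sigmah, forall z : borel4 R,
    Sh_slab Omega node mesh tk phil Theta n z ->
    0 < dot (nrm0 delta z) (nh z)} ;
  resolved_curvature : forall i z,
    Sh_slab Omega node mesh tk phil Theta n z ->
    0 < 1 - delta z * kappa i z }.

(* d(sigma o p) = mu d(sigmah) on A, for p injective on A. *)
Definition measure_ratio (R : realType) (A : set 'rV[R]_4)
    (p : 'rV[R]_4 -> 'rV[R]_4)
    (sigma sigmah : {measure set (borel4 R) -> \bar R})
    (mu : 'rV[R]_4 -> R) : Prop :=
  measurable_fun (A : set (borel4 R)) (mu : borel4 R -> R) /\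
  forall B : set (borel4 R), measurable B -> B `<=` A ->
    sigma (p @` B) = (\int[sigmah]_(z in B) (mu z)%:E)%E.

(* Main.v *)
(* Let p be the closest point map.  On a C^1 patch X of S_h, both X and p o X are
   parametrizations, so the density mu satisfies mu * gram X = gram (p o X) almost
   everywhere, and what remains is linear algebra at one point z.  Put
   N = (n, delta_t), the space-time gradient of delta, and n_0 = (n, 0).  From
   |n| = 1 on U and the symmetry of D^2 delta, the Jacobian P of p at z satisfies
   n_0 P = 0 and P N^T = 0 (row convention), and P + n_0^T N has determinant
   (1 + delta_t^2) prod_i (1 - delta kappa_i).  If the rows of A span the
   orthogonal complement of the unit vector n_h, then
   det (AP (AP)^T) |N|^2 = det (A A^T) (n_0 . n_h)^2 det (P + n_0^T N)^2.
   Differentiating phi o p = 0 shows that the gradient of phi at p(z) is a multiple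
   of N, so that delta_t^2 = V(p(z))^2 and |N| = alpha(p(z)).
   The vector n_h is given by one-sided derivatives on some prism; it is orthogonal
   to the patch at almost every point, because almost every point of the part of
   the patch above a prism is a limit of such points along each coordinate axis. *)
Require Import Defs.
From HB Require Import structures.
From mathcomp Require Import all_boot all_order all_algebra.
From mathcomp Require Import all_classical all_reals all_analysis.
From mathcomp Require Import measurable_realfun.
From mathcomp Require Import ring lra.

Set Implicit Arguments.
Unset Strict Implicit.
Unset Printing Implicit Defensive.

Import Order.TTheory GRing.Theory Num.Theory.
Import numFieldNormedType.Exports.

Local Open Scope classical_set_scope.
Local Open Scope ring_scope.

(** * Determinants *)

(** The identity |n| = 1 is not postulated: it is derived from [delta] being the signed distance and
    from the foot point lying on the surface. Off the zero level this is a Lipschitz argument in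
    which the sign of [phi] is locally constant; on the zero level the sign jumps, and the identity
    is recovered by continuity. At the times 0 and T the set [U] is only relatively open, so
    identities on [U] are differentiated through one-sided increments. The density [mu] is
    characterised only by integrals over Borel sets and is a priori neither nonnegative nor bounded.
    Comparing it with a ratio of Gram factors therefore requires Borel images of patches and a
    truncation. The patches need not respect the prisms. A point that is isolated, along some axis,
    in the part above a prism gives no tangent information there. Such points form a null set: a set
    from which certain small differences never lead back has infinitely many disjoint translates in
    a bounded interval. *)

Lemma det_gram_col_mx (R : comNzRingType) m k (A : 'M[R]_(m, m + k))
    (B C : 'M[R]_(k, m + k)) : A *m C^T = 0 ->
  \det (col_mx A B) * \det (col_mx A C) = \det (A *m A^T) * \det (B *m C^T).
Proof.
(* The product of one matrix with the transpose of the other is block triangular because [A *m C^T]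
   vanishes. *)
move=> hAC; rewrite -[\det (col_mx A C)]det_tr -det_mulmx tr_col_mx mul_col_row hAC.
by rewrite det_lblock.
Qed.

(* Here [u] spans the left kernel of [P] and [N] the orthogonal complement of its
   row space; adding [u^T N] to [P] turns it into an invertible matrix. *)
Lemma det_gram_mulmx (R : idomainType) m k (A : 'M[R]_(m, m + k))
    (P : 'M[R]_(m + k)) (u v N : 'M[R]_(k, m + k)) :
  A *m v^T = 0 -> v *m v^T = 1%:M -> u *m P = 0 -> u *m u^T = 1%:M ->
  P *m N^T = 0 -> \det (A *m A^T) != 0 ->
  \det (A *m P *m (A *m P)^T) * \det (N *m N^T) =
  \det (A *m A^T) * \det (u *m v^T) ^+ 2 * \det (P + u^T *m N) ^+ 2.
Proof.
move=> Av vv uP uu PN A0.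
have dv : \det (col_mx A v) ^+ 2 = \det (A *m A^T).
  by rewrite expr2 det_gram_col_mx// vv det1 mulr1.
have duv := det_gram_col_mx u Av.
have du : \det (col_mx A u) ^+ 2 = \det (A *m A^T) * \det (u *m v^T) ^+ 2.
  (* Squaring [duv] and inserting [dv] leaves one surplus Gram determinant on each side, which is
     nonzero and cancels. *)
  apply: (mulIf A0); rewrite -{1}dv -exprMn duv; ring.
have APN : A *m P *m N^T = 0 by rewrite -mulmxA PN mulmx0.
rewrite -(det_gram_col_mx N APN).
rewrite -du -exprMn -expr2; congr (_ ^+ 2); rewrite -det_mulmx.
rewrite mul_col_mx !mulmxDr uP add0r !mulmxA uu mul1mx.
(* A row operation: multiples of the rows of [N] are removed without changing the determinant. *)
have -> : col_mx (A *m P + A *m u^T *m N) N =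
   block_mx 1%:M (A *m u^T) 0 1%:M *m col_mx (A *m P) N.
  by rewrite mul_block_col !mul1mx mul0mx add0r.
by rewrite det_mulmx det_ublock !det1 !mul1r.
Qed.

(* Schur complement of the block [I - d H^T], which fixes [n^T]. *)
Lemma det_distance_block (R : comNzRingType) k (H : 'M[R]_k) (n nt : 'rV[R]_k)
    (d dt : R) :
  n *m H = 0 -> n *m n^T = 1%:M -> n *m nt^T = 0 ->
  \det (block_mx (1%:M - d *: H^T) (dt *: n^T)
                 (- dt *: n - d *: nt) (1%:M : 'M[R]_1)) =
  \det (1%:M - d *: H) * (1 + dt ^+ 2).
Proof.
move=> nH nn nnt.
have Hn : H^T *m n^T = 0 by rewrite -trmx_mul nH trmx0.
have ntn : nt *m n^T = 0 by rewrite -[nt]trmxK -trmx_mul nnt trmx0.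
have -> : \det (1%:M - d *: H) = \det (1%:M - d *: H^T).
  by rewrite -[LHS]det_tr raddfB /= trmx1 linearZ.
pose C : 'M[R]_(k + 1) := block_mx 1%:M (- dt *: n^T) 0 1%:M.
have <- : \det (block_mx (1%:M - d *: H^T) (dt *: n^T)
                 (- dt *: n - d *: nt) (1%:M : 'M[R]_1) *m C) =
   \det (block_mx (1%:M - d *: H^T) (dt *: n^T)
                 (- dt *: n - d *: nt) (1%:M : 'M[R]_1)).
  by rewrite det_mulmx det_ublock !det1 !mulr1.
rewrite mulmx_block !mulmx1 !mulmx0 !addr0.
rewrite mulmxBl mul1mx -!scalemxAr -scalemxAl Hn !scaler0 subr0.
rewrite [X in block_mx _ X]addrC -scalerDl subrr scale0r det_lblock.
congr (_ * _); rewrite mulmxBl -!scalemxAl nn ntn scaler0 subr0.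
by rewrite scalerA mulrNN det_mx11 !mxE eqxx /= mulr1n expr2 mulr1 addrC.
Qed.

(** For nonzero d the left side is d^3 times the characteristic polynomial at 1/d. The factor 'X
    cancels one power of d, and the other two are distributed over the product. *)
Lemma det_sub_scale (R : fieldType) (H : 'M[R]_3) (d : R) (k : 'I_2 -> R) :
  char_poly H = 'X * \prod_(i < 2) ('X - (k i)%:P) ->
  \det (1%:M - d *: H) = \prod_(i < 2) (1 - d * k i).
Proof.
move=> cH; have [->|d0] := eqVneq d 0.
  by rewrite scale0r subr0 det1 big1// => i _; rewrite mul0r subr0.
have -> : 1%:M - d *: H = d *: (d^-1%:M - H).
  by rewrite scalerBr scale_scalar_mx divff.
rewrite detZ; have := congr1 (fun p => p.[d^-1]) cH.
rewrite /char_poly -horner_evalE -det_map_mx.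
have -> : map_mx (horner_eval d^-1) (char_poly_mx H) = d^-1%:M - H.
  by apply/matrixP=> i j; rewrite !mxE horner_evalE !hornerE hornerMn hornerX.
move->; rewrite !hornerE horner_prod !big_ord_recl !big_ord0 !hornerE.
rewrite /= !mulr1; by field.
Qed.

(** * Euclidean vectors and differentials *)

Lemma dotE (R : realType) n (u v : 'rV[R]_n) : dot u v = (u *m v^T) 0 0.
Proof. by rewrite mxE; apply: eq_bigr => i _; rewrite mxE. Qed.

Lemma mulmx_trE (R : realType) n (u v : 'rV[R]_n) : u *m v^T = (dot u v)%:M.
Proof. by rewrite dotE -mx11_scalar. Qed.

Lemma dotC (R : realType) n (u v : 'rV[R]_n) : dot u v = dot v u.
Proof. by apply: eq_bigr => i _; rewrite mulrC. Qed.

Lemma dotDl (R : realType) n (u v w : 'rV[R]_n) :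
  dot (u + v) w = dot u w + dot v w.
Proof. by rewrite !dotE mulmxDl mxE. Qed.

Lemma dotZl (R : realType) n a (u v : 'rV[R]_n) : dot (a *: u) v = a * dot u v.
Proof. by rewrite !dotE -scalemxAl mxE. Qed.

Lemma dotDr (R : realType) n (u v w : 'rV[R]_n) :
  dot u (v + w) = dot u v + dot u w.
Proof. by rewrite dotC dotDl !(dotC u). Qed.

Lemma dotZr (R : realType) n a (u v : 'rV[R]_n) : dot u (a *: v) = a * dot u v.
Proof. by rewrite dotC dotZl dotC. Qed.

Lemma dot_ge0 (R : realType) n (u : 'rV[R]_n) : 0 <= dot u u.
Proof. by apply: sumr_ge0 => i _; rewrite -expr2 sqr_ge0. Qed.

Lemma dot_eq0 (R : realType) n (u : 'rV[R]_n) : (dot u u == 0) = (u == 0).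
Proof.
apply/idP/eqP => [|->]; last by rewrite dotE mul0mx mxE.
rewrite psumr_eq0 => [/allP u0|i _]; last by rewrite -expr2 sqr_ge0.
apply/rowP => i; have /= := u0 i (mem_index_enum i).
by rewrite mulf_eq0 orbb mxE => /eqP.
Qed.

Lemma enorm_ge0 (R : realType) n (u : 'rV[R]_n) : 0 <= enorm u.
Proof. exact: sqrtr_ge0. Qed.

Lemma sqr_enorm (R : realType) n (u : 'rV[R]_n) : enorm u ^+ 2 = dot u u.
Proof. by rewrite sqr_sqrtr// dot_ge0. Qed.

Lemma enorm_eq0 (R : realType) n (u : 'rV[R]_n) : (enorm u == 0) = (u == 0).
Proof. by rewrite -dot_eq0 -sqr_enorm sqrf_eq0. Qed.

Lemma enormZ (R : realType) n a (u : 'rV[R]_n) :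
  enorm (a *: u) = `|a| * enorm u.
Proof.
rewrite /enorm dotZl dotZr mulrA -expr2 sqrtrM ?sqr_ge0//.
by rewrite sqrtr_sqr.
Qed.

Lemma enorm_normalize (R : realType) n (u : 'rV[R]_n) :
  u != 0 -> enorm (normalize u) = 1.
Proof.
by move=> u0; rewrite enormZ ger0_norm ?invr_ge0 ?enorm_ge0// mulVf// enorm_eq0.
Qed.

(** Cauchy-Schwarz, from the squared length of (v.v) u - (u.v) v being nonnegative. *)
Lemma ler_norm_dot (R : realType) n (u v : 'rV[R]_n) :
  `|dot u v| <= enorm u * enorm v.
Proof.
rewrite -(@ler_pXn2r _ 2)// ?nnegrE ?mulr_ge0 ?enorm_ge0//.
rewrite exprMn !sqr_enorm real_normK ?num_real//.
have [->|v0] := eqVneq v 0.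
  by rewrite !dotE trmx0 !mulmx0 !mxE expr0n mulr0.
have vv : 0 < dot v v by rewrite lt_neqAle eq_sym dot_eq0 v0 dot_ge0.
have := dot_ge0 (dot v v *: u + (- dot u v) *: v).
have -> : dot (dot v v *: u + (- dot u v) *: v) (dot v v *: u + (- dot u v) *: v)
    = dot v v * (dot u u * dot v v - dot u v ^+ 2).
  by rewrite !(dotDl, dotDr, dotZl, dotZr) (dotC v u); ring.
by rewrite pmulr_rge0// subr_ge0.
Qed.

Lemma ler_enormD (R : realType) n (u v : 'rV[R]_n) :
  enorm (u + v) <= enorm u + enorm v.
Proof.
rewrite -(@ler_pXn2r _ 2)// ?nnegrE ?addr_ge0 ?enorm_ge0//.
rewrite sqrrD !sqr_enorm dotDl !dotDr (dotC v u).
have := le_trans (ler_norm _) (ler_norm_dot u v); lra.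
Qed.

Lemma diff_near (R : numFieldType) (V W : normedModType R) (f : V -> W) x e :
  differentiable f x -> 0 < e ->
  \forall h \near 0, `|f (x + h) - f x - 'd f x h| <= e * `|h|.
Proof.
move=> /diff_locallyxC df e0.
have /eqaddoP /(_ e e0) : (fun h => f (x + h)) =
    (fun h => f x + 'd f x h) +o_ 0 id by apply/funext => h; exact: df.
by apply: filterS => h /=; rewrite opprD addrA.
Qed.

Lemma mul_rV_jacobian (R : numFieldType) m n (f : 'rV[R]_m -> 'rV[R]_n) x v :
  v *m 'J f x = 'd f x v.
Proof. by rewrite mul_rV_lin1. Qed.

Lemma diff_grad (R : realType) n (f : 'rV[R]_n -> R) x v :
  differentiable f x -> 'd f x v = dot v (grad f x).
Proof.
move=> df; rewrite {1}[v]row_sum_delta linear_sum; apply: eq_bigr => i _.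
by rewrite linearZ /= mxE deriveE.
Qed.

Lemma differentiable_rV (R : realType) (V : normedModType R) n
    (f : V -> 'rV[R]_n) x :
  (forall j, differentiable (fun y => f y 0 j) x) -> differentiable f x.
Proof.
move=> df; have -> : f = \sum_(j < n) (fun y => f y 0 j *: delta_mx 0 j).
  by apply/funext => y; rewrite fct_sumE -row_sum_delta.
by apply: differentiable_sum => j; exact: differentiableZl.
Qed.

Lemma diff_rV (R : realType) (V : normedModType R) n (f : V -> 'rV[R]_n) x v j :
  differentiable f x -> ('d f x v) 0 j = 'd (fun y => f y 0 j) x v.
Proof.
move=> df; rewrite -!deriveE//; first by rewrite derive_mx ?mxE//; exact: diff_derivable.
exact: differentiable_comp df (differentiable_coord _ _ _).
Qed.

(** * Symmetry of second derivatives *)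

Lemma is_derive_line (R : realType) n (f : 'rV[R]_n -> R) (y u : 'rV[R]_n)
    (t : R) :
  differentiable f (y + t *: u) ->
  is_derive t (1 : R) (fun s : R => f (y + s *: u)) ('D_u f (y + t *: u)).
Proof.
move=> df.
have E : (fun h : R => h^-1 *: (f (h *: u + (y + t *: u)) - f (y + t *: u))) =
   (fun h : R => h^-1 *: ((((fun s : R => f (y + s *: u))) \o shift t) (h *: 1)
      - f (y + t *: u))).
  apply/funext => h /=; congr (_ *: (f _ - _)).
  by rewrite [h *: 1]mulr1 scalerDl addrCA.
have dv := @diff_derivable _ _ _ f _ u df.
by split; rewrite /derivable/derive/= -E.
Qed.

(* The mean value theorem applied to [t |-> f (x + t u + h v) - f (x + t u)]. *)
Lemma second_difference (R : realType) n (O : set 'rV[R]_n) (f : 'rV[R]_n -> R)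
    (x u v : 'rV[R]_n) e :
  open O -> (forall y, O y -> differentiable f y) -> O x ->
  differentiable ('D_u f) x -> 0 < e ->
  \forall h \near (0 : R)^'+,
    `|f (x + h *: u + h *: v) - f (x + h *: u) - f (x + h *: v) + f x
      - h ^+ 2 * 'D_v ('D_u f) x| <= e * h ^+ 2.
Proof.
move=> oO df Ox du e0.
(* For 0 <= t <= h both increments t u and h v + t u have norm at most h C. Their two linearisation
   errors, each with factor e / (2 C), then add up to at most e h. The summand 1 keeps C
   positive. *)
pose C := 1 + `|u| + `|v|.
have C0 : 0 < C by rewrite /C; have := normr_ge0 u; have := normr_ge0 v; lra.
have e'0 : 0 < e / (2 * C) by rewrite divr_gt0// mulr_gt0.
have : \forall k \near (0 : 'rV[R]_n),
    `|'D_u f (x + k) - 'D_u f x - 'd ('D_u f) x k| <= e / (2 * C) * `|k| /\ O (x + k).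
  have A := diff_near du e'0; apply: filterI; first exact: A.
  exact: ((nbhs0P O x).1 (open_nbhs_nbhs (conj oO Ox))).
move=> /nbhs_ballP[r /= r0 hr].
have {}hr k : `|k| < r ->
    `|'D_u f (x + k) - 'D_u f x - 'd ('D_u f) x k| <= e / (2 * C) * `|k| /\ O (x + k).
  by move=> kr; apply: hr; rewrite -ball_normE /= sub0r normrN.
near=> h.
have h0 : 0 < h by near: h; exact: nbhs_right_gt.
have hC : h * C < r.
  by rewrite -ltr_pdivlMr//; near: h; apply: nbhs_right_lt; rewrite divr_gt0.
have norm1 t : 0 <= t <= h -> `|t *: u| <= h * C /\ `|h *: v + t *: u| <= h * C.
  move=> /andP[t0 th]; have tu : `|t *: u| <= h * `|u|.
    by rewrite normrZ ger0_norm// ler_wpM2r.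
  have hv : `|h *: v| = h * `|v| by rewrite normrZ gtr0_norm.
  have hu : 0 <= h * `|v| by rewrite mulr_ge0// ltW.
  split; first by rewrite /C !mulrDr; lra.
  by rewrite (le_trans (ler_normD _ _))// hv /C !mulrDr; lra.
pose g := fun t : R => f (x + h *: v + t *: u) - f (x + t *: u).
have dg t : 0 <= t <= h -> is_derive t (1 : R) g
    ('D_u f (x + h *: v + t *: u) - 'D_u f (x + t *: u)).
  move=> th; have [a b] := norm1 t th.
  apply: is_deriveB; apply: is_derive_line; apply: df.
    by rewrite -addrA; exact: (hr _ (le_lt_trans b hC)).2.
  exact: (hr _ (le_lt_trans a hC)).2.
have [t|t|c] := @MVT R g (fun t => 'D_u f (x + h *: v + t *: u) - 'D_u f (x + t *: u))
    0 h h0.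
- by rewrite in_itv /= => /andP[t0 th]; apply: dg; rewrite !ltW.
- apply: derivable_within_continuous => t'; rewrite in_itv /= => th.
  by have [] := dg t' th.
rewrite in_itv /= => /andP[c0 ch].
have /norm1[ca cb] : 0 <= c <= h by rewrite !ltW.
rewrite /g !scale0r !addr0 subr0.
have -> : f (x + h *: u + h *: v) - f (x + h *: u) - f (x + h *: v) + f x =
  f (x + h *: v + h *: u) - f (x + h *: u) - (f (x + h *: v) - f x).
  by rewrite (addrAC x); ring.
move=> ->; rewrite (_ : _ - _ = h * ('D_u f (x + h *: v + c *: u) - 'D_u f (x + c *: u)
   - h * 'D_v ('D_u f) x)); last by ring.
rewrite normrM gtr0_norm// expr2 (mulrCA e) ler_pM2l//.
have [A _] := hr _ (le_lt_trans ca hC).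
have [B _] := hr _ (le_lt_trans cb hC).
rewrite addrA in B.
set a := 'D_u f (x + h *: v + _) in B *; set b := 'D_u f (x + _) in A *.
rewrite linearD /= [X in _ - (X + _)]linearZ /= in B.
rewrite deriveE//; set l := 'd _ x v in B *; set k := 'd _ x _ in A B.
have -> : a - b - h * l = a - 'D_u f x - (h *: l + k) - (b - 'D_u f x - k).
  by rewrite /GRing.scale /=; ring.
rewrite (le_trans (ler_normB _ _))//.
have e'C : e / (2 * C) * (h * C) = e / 2 * h by field; rewrite gt_eqF.
have := le_trans A (ler_wpM2l (ltW e'0) ca).
have := le_trans B (ler_wpM2l (ltW e'0) cb).
rewrite e'C; lra.
Unshelve. all: by end_near. Qed.

(** The second difference is symmetric in u and v, and after division by h^2 it approximates both
    mixed derivatives. Only differentiability of the first derivatives at x enters, not continuity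
    of the second ones. *)
Lemma derive_comm (R : realType) n (O : set 'rV[R]_n) (f : 'rV[R]_n -> R)
    (x u v : 'rV[R]_n) :
  open O -> Ck 2 O f -> O x -> 'D_v ('D_u f) x = 'D_u ('D_v f) x.
Proof.
move=> oO [df d2f] Ox; apply/eqP; rewrite -subr_eq0 -normr_le0; apply/ler_addgt0Pr.
move=> e e0; rewrite add0r.
have e20 : 0 < e / 2 by rewrite divr_gt0.
have duf w : differentiable ('D_w f) x by exact: (d2f w).1.
have A := second_difference v oO df Ox (duf u) e20.
have B := second_difference u oO df Ox (duf v) e20.
have [h [[{}A {}B] h0]] := filter_ex (filterI (filterI A B) (nbhs_right_gt 0)).
have {}h0 : 0 < h by [].
move: A B.
rewrite (addrAC x) (addrAC (f (x + _ + _))); move: (_ + f x) => S.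
move: ('D_v _ x) ('D_u _ x) => p q A B.
rewrite -(@ler_pM2l _ (h ^+ 2)) ?exprn_gt0//.
rewrite -[X in X * `|_|]gtr0_norm ?exprn_gt0// -normrM.
have -> : h ^+ 2 * (p - q) = (S - h ^+ 2 * q) - (S - h ^+ 2 * p) by ring.
rewrite (le_trans (ler_normB _ _))//; lra.
Qed.

(** * Space-time vectors *)

Lemma spst (R : realType) (x : 'rV[R]_3) t : sp (st x t) = x.
Proof. exact: row_mxKl. Qed.

Lemma tmst (R : realType) (x : 'rV[R]_3) t : tm (st x t) = t.
Proof.
rewrite /tm /st (_ : ord_max = rshift 3 ord0); last exact: val_inj.
by rewrite [LHS](row_mxEr x (t%:M : 'M[R]_1)) mxE eqxx mulr1n.
Qed.

Lemma spmax (R : realType) (z : 'rV[R]_4) : rsubmx (z : 'rV[R]_(3 + 1)) = (tm z)%:M.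
Proof.
apply/matrixP => i j; rewrite !ord1 !mxE eqxx mulr1n /tm; congr (z _ _).
exact: val_inj.
Qed.

Lemma stK (R : realType) (z : 'rV[R]_4) : st (sp z) (tm z) = z.
Proof. by rewrite /st -spmax; exact: (@hsubmxK _ 1 3 1 z). Qed.

Lemma st_eq (R : realType) (z y : 'rV[R]_4) : sp z = sp y -> tm z = tm y -> z = y.
Proof. by move=> E F; rewrite -[z]stK E F stK. Qed.

Lemma spD (R : realType) (z y : 'rV[R]_4) : sp (z + y) = sp z + sp y.
Proof. exact: raddfD. Qed.

Lemma spZ (R : realType) a (z : 'rV[R]_4) : sp (a *: z) = a *: sp z.
Proof. exact: linearZ. Qed.

Lemma tmD (R : realType) (z y : 'rV[R]_4) : tm (z + y) = tm z + tm y.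
Proof. by rewrite /tm mxE. Qed.

Lemma tmZ (R : realType) a (z : 'rV[R]_4) : tm (a *: z) = a * tm z.
Proof. by rewrite /tm mxE. Qed.

Lemma dot_st (R : realType) (z y : 'rV[R]_4) :
  dot z y = dot (sp z) (sp y) + tm z * tm y.
Proof.
rewrite /dot big_ord_recr /=; congr (_ + _); apply: eq_bigr => i _.
by rewrite !mxE; congr (z _ _ * y _ _); exact: val_inj.
Qed.

Lemma st_delta (R : realType) (j : 'I_3) :
  st (delta_mx 0 j) 0 = delta_mx 0 (lshift 1 j) :> 'rV[R]_4.
Proof. by rewrite [RHS](@delta_mx_lshift R 1 3 1 0 j) /st raddf0. Qed.

Lemma st_delta_max (R : realType) : st 0 1 = delta_mx 0 (rshift 3 0) :> 'rV[R]_4.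
Proof.
rewrite /st (_ : 1%:M = delta_mx 0 0 :> 'M[R]_1).
  exact: esym (@delta_mx_rshift R 1 3 1 0 0).
by apply/matrixP => i j; rewrite !ord1 !mxE.
Qed.

Lemma continuous_sp (R : realType) : continuous (@sp R).
Proof. exact: (@continuous_lsubmx R 1 3 1). Qed.

(** * One-sided increments in the space-time cylinder *)

(** Increments along a single ray suffice, which is all that remains at the times 0 and T. *)
Lemma diff_norm_le (R : realType) n (V : normedModType R) (f : 'rV[R]_n -> V)
    x v C :
  differentiable f x ->
  (\forall r \near (0 : R)^'+, `|f (x + r *: v) - f x| <= r * C) ->
  `|'d f x v| <= C.
Proof.
move=> df fC; apply/ler_addgt0Pr => e e0.
(* The summand 1 covers the case v = 0. *)
have e'0 : 0 < e / (`|v| + 1) by rewrite divr_gt0// ltr_wpDl.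
have /nbhs_ballP[d /= d0 hd] := diff_near df e'0.
have dv : 0 < d / (`|v| + 1) by rewrite divr_gt0// ltr_wpDl.
have [r [[h r0] rd]] := filter_ex (filterI (filterI fC (nbhs_right_gt 0))
  (nbhs_right_lt dv)).
have {}r0 : 0 < r := r0.
have {}rd : r < d / (`|v| + 1) := rd.
have rv : `|r *: v| = r * `|v| by rewrite normrZ gtr0_norm.
have /hd /= : ball 0 d (r *: v).
  rewrite -ball_normE /= sub0r normrN rv.
  rewrite ltr_pdivlMr in rd; last by rewrite ltr_wpDl.
  by rewrite (le_lt_trans _ rd)// ler_wpM2l ?lerDl// ltW.
rewrite linearZ /= rv => k.
rewrite -(ler_pM2l r0) -[X in X * `|_|](gtr0_norm r0) -normrZ.
rewrite -[r *: 'd f x v](subKr (f (x + r *: v) - f x)) (le_trans (ler_normB _ _))//.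
rewrite mulrDr lerD// (le_trans k)// mulrCA ler_pM2l//.
by rewrite mulrAC ler_pdivrMr ?ltr_wpDl// ler_wpM2l ?lerDl// ltW.
Qed.

Lemma cvg_ray (R : realType) n (z v : 'rV[R]_n) :
  (fun r : R => z + r *: v) @ (0 : R)^'+ --> z.
Proof.
apply: cvg_within_filter.
have : (fun r : R => z + r *: v) @ (0 : R) --> z + (0 : R) *: v.
  by apply: cvgD; [exact: cvg_cst | exact: scalel_continuous].
by rewrite scale0r addr0.
Qed.

(** A ray can leave the cylinder at once only by pointing forward at time T or backward at time 0;
    the last two hypotheses exclude this. *)
Lemma relatively_open_ray (R : realType) (Omega : set 'rV[R]_3) (T : R)
    (O : set 'rV[R]_4) (z v : 'rV[R]_4) :
  open Omega -> open O -> (cylinder Omega `[0, T] `&` O) z ->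
  (0 < tm v -> tm z < T) -> (tm v < 0 -> 0 < tm z) ->
  \forall r \near (0 : R)^'+, (cylinder Omega `[0, T] `&` O) (z + r *: v).
Proof.
move=> oOm oO [[Omz]]; rewrite /= in_itv /= => /andP[z0 zT] Oz vT v0.
have line := @cvg_ray R _ z v.
have A : \forall r \near (0 : R)^'+, O (z + r *: v).
  by apply: line; exact: open_nbhs_nbhs.
have B : \forall r \near (0 : R)^'+, Omega (sp (z + r *: v)).
  by apply: (cvg_comp _ _ line (@continuous_sp R z)); exact: open_nbhs_nbhs.
have C : \forall r \near (0 : R)^'+, 0 <= tm (z + r *: v) <= T.
  have [vn|vp|v00] := ltgtP (tm v) 0.
  - have z0' : 0 < tm z / - tm v by rewrite divr_gt0 ?oppr_gt0// v0.
    near=> r; have r0 : 0 < r by near: r; exact: nbhs_right_gt.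
    have : r < tm z / - tm v by near: r; exact: nbhs_right_lt.
    rewrite tmD tmZ ltr_pdivlMr ?oppr_gt0// => h; nra.
  - have zT' : 0 < (T - tm z) / tm v by rewrite divr_gt0// subr_gt0 vT.
    near=> r; have r0 : 0 < r by near: r; exact: nbhs_right_gt.
    have : r < (T - tm z) / tm v by near: r; exact: nbhs_right_lt.
    rewrite tmD tmZ ltr_pdivlMr// => h; nra.
  - by near=> r; rewrite tmD tmZ v00 mulr0 addr0 z0.
by near=> r; split; [split; near: r|near: r].
Unshelve. all: by end_near. Qed.

(* At the times [0] and [T] only one-sided increments are available, but one of
   [v] and [- v] always points into the cylinder. *)
Lemma diff_eq0_relatively_open (R : realType) (Omega : set 'rV[R]_3) (T : R)
    (O : set 'rV[R]_4) (V : normedModType R) (f : 'rV[R]_4 -> V) (c : V) z v :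
  open Omega -> open O -> 0 < T -> (cylinder Omega `[0, T] `&` O) z ->
  differentiable f z ->
  (forall y, (cylinder Omega `[0, T] `&` O) y -> f y = c) -> 'd f z v = 0.
Proof.
move=> oOm oO T0 Uz df fc.
suff ray u : (0 < tm u -> tm z < T) -> (tm u < 0 -> 0 < tm z) -> 'd f z u = 0.
  have [zT|zT] := ltP (tm z) T.
    have [v0|v0] := leP 0 (tm v).
      by apply: ray => // /lt_geF; rewrite v0.
    apply/eqP; rewrite -oppr_eq0 -linearN; apply/eqP; apply: ray => //.
    by rewrite -scaleN1r tmZ mulN1r oppr_lt0 => /lt_gtF; rewrite v0.
  have z0 : 0 < tm z by exact: lt_le_trans zT.
  have [v0|v0] := leP (tm v) 0.
    by apply: ray => // /lt_geF; rewrite v0.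
  apply/eqP; rewrite -oppr_eq0 -linearN; apply/eqP; apply: ray => //.
  by rewrite -scaleN1r tmZ mulN1r oppr_gt0 => /lt_gtF; rewrite v0.
move=> uT u0; apply/eqP; rewrite -normr_le0; apply: diff_norm_le => //.
apply: filterS (relatively_open_ray oOm oO Uz uT u0) => r Ur.
by rewrite !fc// subrr normr0 mulr0.
Qed.

(** * The signed distance function *)

Lemma has_inf_enorm (R : realType) n (G : set 'rV[R]_n) x :
  G !=set0 -> has_inf [set enorm (x - y) | y in G].
Proof.
move=> [y Gy]; split; first by exists (enorm (x - y)), y.
by exists 0 => _ [w _ <-]; exact: enorm_ge0.
Qed.

Lemma inf_enorm_lipschitz (R : realType) n (G : set 'rV[R]_n) x x' :
  G !=set0 ->
  `|inf [set enorm (x - y) | y in G] - inf [set enorm (x' - y) | y in G]|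
  <= enorm (x - x').
Proof.
move=> G0.
have half u u' : inf [set enorm (u - y) | y in G] <=
    inf [set enorm (u' - y) | y in G] + enorm (u - u').
  rewrite -lerBlDr; apply: lb_le_inf; first by case: (has_inf_enorm u' G0).
  move=> _ [y Gy <-]; rewrite lerBlDr.
  apply: (@le_trans _ _ (enorm (u - y))).
    by apply: ge_inf; [case: (has_inf_enorm u G0) | exists y].
  by rewrite -[u - y](subrKA u') addrC ler_enormD.
have E : enorm (x' - x) = enorm (x - x').
  by rewrite -[x' - x]opprB -scaleN1r enormZ normrN1 mul1r.
have := half x x'; have := half x' x; rewrite E ler_norml => h1 h2.
by apply/andP; split; lra.
Qed.

Lemma neighborhood_horizontal_ray (R : realType) (Omega : set 'rV[R]_3) (T : R)
    (w : 'rV[R]_4 -> 'rV[R]_3) (phi : 'rV[R]_4 -> R) (U : set 'rV[R]_4) z v :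
  evolving_surface Omega T w phi -> surface_neighborhood Omega T phi U ->
  U z -> \forall r \near (0 : R)^'+, U (z + r *: st v 0).
Proof.
move=> hs hU Uz; have [D [oD UE]] := neighborhood_open hU.
rewrite UE in Uz *; apply: relatively_open_ray => //; first exact: domain_open hs.
  by rewrite tmst ltxx.
by rewrite tmst ltxx.
Qed.

Lemma U_sub_cylinder (R : realType) (Omega : set 'rV[R]_3) (T : R)
    (phi : 'rV[R]_4 -> R) (U : set 'rV[R]_4) :
  surface_neighborhood Omega T phi U -> U `<=` cylinder Omega `[0, T].
Proof. by move=> /neighborhood_open[D [_ ->]] z []. Qed.

Lemma diff_st0 (R : realType) (f : 'rV[R]_4 -> R) z v :
  differentiable f z -> 'd f z (st v 0) = dot v (sgrad f z).
Proof. by move=> df; rewrite diff_grad// dot_st spst tmst mul0r addr0. Qed.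

Lemma phi_differentiable (R : realType) (Omega : set 'rV[R]_3) (T : R)
    (w : 'rV[R]_4 -> 'rV[R]_3) (phi : 'rV[R]_4 -> R) z :
  evolving_surface Omega T w phi -> cylinder Omega `[0, T] z ->
  differentiable phi z.
Proof. by move=> hs cz; have [D [_ /(_ z cz) Dz [+ _]]] := level_set_C1 hs; exact. Qed.

(** Lower bound: |delta| |n| is the distance from x to its foot point, which lies on the surface, so
    it is at least the infimum |delta|; and delta is nonzero, since otherwise z would be its own
    foot point. Upper bound: the distance is 1-Lipschitz in space and the sign of [phi] is constant
    nearby, so the derivative |n|^2 of [delta] along n is at most |n|. *)
Lemma eikonal_off_surface (R : realType) (Omega : set 'rV[R]_3) (T : R)
    (w : 'rV[R]_4 -> 'rV[R]_3) (phi : 'rV[R]_4 -> R) (U : set 'rV[R]_4)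
    (delta : 'rV[R]_4 -> R) (kappa : 'I_2 -> 'rV[R]_4 -> R) z :
  evolving_surface Omega T w phi -> surface_neighborhood Omega T phi U ->
  projection_setting Omega T phi U delta kappa ->
  U z -> phi z != 0 -> enorm (nrm delta z) = 1.
Proof.
move=> hs hU hp Uz phiz.
have [D [oD UD [dD _]]] := delta_smooth hp.
have dd := dD z (UD z Uz).
have [tz [Omp phip]] := proj_to_S hp Uz; rewrite /closest spst tmst in tz Omp phip.
have d0 : delta z != 0.
  apply: contraNneq phiz => d0; rewrite -[z]stK; move: phip.
  by rewrite d0 scale0r subr0 => ->.
have G0 : Gamma Omega phi (tm z) !=set0 by exists (sp z - delta z *: nrm delta z).
set n := nrm delta z in Omp phip G0 *.
have sg1 : `|Num.sg (phi z)| = 1 by rewrite normr_sg phiz.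
apply/le_anti/andP; split; last first.
  rewrite -(@ler_pM2l _ `|delta z|) ?normr_gt0// mulr1 -enormZ.
  rewrite {1}(delta_def hp Uz) normrM sg1 mul1r ger0_norm; last first.
    apply: lb_le_inf; first by case: (has_inf_enorm (sp z) G0).
    by move=> _ [y _ <-]; exact: enorm_ge0.
  apply: ge_inf; first by case: (has_inf_enorm (sp z) G0).
  by exists (sp z - delta z *: n) => //; rewrite subKr.
have bound : `|'d delta z (st n 0)| <= enorm n.
  apply: diff_norm_le => //.
  have sgr : \forall r \near (0 : R)^'+, Num.sg (phi (z + r *: st n 0)) = Num.sg (phi z).
    have cz : {for z, continuous phi}.
      apply: differentiable_continuous; apply: (phi_differentiable hs).
      exact: (U_sub_cylinder hU).
    have cphi := cvg_comp _ _ (@cvg_ray _ _ z (st n 0)) cz.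
    have [pz|pz|pz] := ltgtP (phi z) 0; last by rewrite pz eqxx in phiz.
      have A : \forall r \near (0 : R)^'+, phi (z + r *: st n 0) < 0.
        exact: (cphi _ (lt_nbhsl pz)).
      by apply: filterS A => r h; rewrite !ltr0_sg.
    have A : \forall r \near (0 : R)^'+, 0 < phi (z + r *: st n 0).
      exact: (cphi _ (lt_nbhsr pz)).
    by apply: filterS A => r h; rewrite !gtr0_sg.
  near=> r.
  have r0 : 0 < r by near: r; exact: nbhs_right_gt.
  have Ur : U (z + r *: st n 0).
    by near: r; exact: (neighborhood_horizontal_ray n hs hU Uz).
  rewrite (delta_def hp Ur) (delta_def hp Uz) /signed_distance.
  have -> : Num.sg (phi (z + r *: st n 0)) = Num.sg (phi z) by near: r.
  rewrite -mulrBr normrM sg1 mul1r tmD tmZ tmst mulr0 addr0 spD spZ spst.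
  rewrite (le_trans (inf_enorm_lipschitz _ _ G0))// addrC addKr enormZ.
  by rewrite gtr0_norm.
have := le_trans (ler_norm _) bound; rewrite diff_st0// -/(nrm delta z) -/n.
rewrite -sqr_enorm => h; have := enorm_ge0 n; nra.
Unshelve. all: by end_near. Qed.

(** * The spatial normal and the Jacobian of the closest point map *)

Lemma st_lshift (R : realType) (x : 'rV[R]_3) t (i : 'I_3) : st x t 0 (lshift 1 i) = x 0 i.
Proof. exact: (row_mxEl x (t%:M : 'M[R]_1)). Qed.

Lemma st_rshift (R : realType) (x : 'rV[R]_3) t (i : 'I_1) : st x t 0 (rshift 3 i) = t.
Proof. by rewrite [LHS](row_mxEr x (t%:M : 'M[R]_1)) ord1 mxE eqxx mulr1n. Qed.

Lemma dot_selfE (R : realType) (V : normedModType R) n (g : V -> 'rV[R]_n) :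
  (fun y => dot (g y) (g y)) =
  \sum_(i < n) ((fun y => g y 0 i) * (fun y => g y 0 i)).
Proof. by apply/funext => y; rewrite fct_sumE. Qed.

Lemma differentiable_coord_comp (R : realType) (V : normedModType R) n
    (g : V -> 'rV[R]_n) z i :
  differentiable g z -> differentiable (fun y => g y 0 i) z.
Proof. by move=> dg; apply: differentiable_comp dg (differentiable_coord _ _ _). Qed.

Lemma differentiable_dot_self (R : realType) (V : normedModType R) n
    (g : V -> 'rV[R]_n) z :
  differentiable g z -> differentiable (fun y => dot (g y) (g y)) z.
Proof.
move=> dg; rewrite dot_selfE; apply: differentiable_sum => i.
by apply: differentiableM; exact: differentiable_coord_comp.
Qed.

Lemma diff_dot_self (R : realType) (V : normedModType R) n
    (g : V -> 'rV[R]_n) z v :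
  differentiable g z ->
  'd (fun y => dot (g y) (g y)) z v = dot (g z) ('d g z v) *+ 2.
Proof.
move=> dg; rewrite -deriveE; last exact: differentiable_dot_self.
have dgi i := @differentiable_coord_comp _ _ _ g z i dg.
rewrite dot_selfE derive_sum => [|i]; last first.
  by apply: derivableM; exact: diff_derivable.
rewrite mulr2n -big_split; apply: eq_bigr => i _ /=.
by rewrite deriveM ?deriveE ?diff_rV//; exact: diff_derivable.
Qed.

Lemma differentiable_derive (R : realType) n (D : set 'rV[R]_n)
    (f : 'rV[R]_n -> R) z v :
  Ck 2 D f -> D z -> differentiable (fun x => 'D_v f x) z.
Proof. by move=> [_ /(_ v)[+ _]]; exact. Qed.

Lemma differentiable_nrm (R : realType) (D : set 'rV[R]_4)
    (delta : 'rV[R]_4 -> R) z :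
  Ck 2 D delta -> D z -> differentiable (nrm delta) z.
Proof.
move=> C2 Dz; apply: differentiable_rV => j.
rewrite (_ : (fun _ => _) = fun x => 'D_(delta_mx 0 (lshift 1 j)) delta x).
  exact: differentiable_derive C2 Dz.
by apply/funext => y; rewrite /nrm /sgrad /sp !mxE.
Qed.

Lemma nrm0_lshift (R : realType) (delta : 'rV[R]_4 -> R) (i : 'I_3) :
  (fun y => nrm0 delta y 0 (lshift 1 i)) = (fun y => nrm delta y 0 i).
Proof. by apply/funext => y; rewrite /nrm0 st_lshift. Qed.

Lemma nrm0_rshift (R : realType) (delta : 'rV[R]_4 -> R) (i : 'I_1) :
  (fun y => nrm0 delta y 0 (rshift 3 i)) = cst 0.
Proof. by apply/funext => y; rewrite /nrm0 st_rshift. Qed.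

Lemma differentiable_nrm0 (R : realType) (delta : 'rV[R]_4 -> R) z :
  differentiable (nrm delta) z -> differentiable (nrm0 delta) z.
Proof.
move=> dn; apply: differentiable_rV => j.
case: (split_ordP (j : 'I_(3 + 1))) => i ->.
  by rewrite nrm0_lshift; exact: differentiable_coord_comp.
by rewrite nrm0_rshift.
Qed.

Lemma diff_nrm0 (R : realType) (delta : 'rV[R]_4 -> R) z v :
  differentiable (nrm delta) z ->
  'd (nrm0 delta) z v = st ('d (nrm delta) z v) 0.
Proof.
move=> dn; have dn0 := differentiable_nrm0 dn.
apply/rowP => j; rewrite diff_rV//.
case: (split_ordP (j : 'I_(3 + 1))) => i ->.
  by rewrite nrm0_lshift st_lshift diff_rV.
by rewrite nrm0_rshift st_rshift diff_cst.
Qed.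

Lemma closestE (R : realType) (delta : 'rV[R]_4 -> R) z :
  closest delta z = z - delta z *: nrm0 delta z.
Proof.
rewrite /closest /nrm0 -!scaleNr; apply: st_eq; rewrite ?spst ?tmst.
  by rewrite spD spZ spst.
by rewrite tmD tmZ tmst mulr0 addr0.
Qed.

Lemma closest_coordE (R : realType) (delta : 'rV[R]_4 -> R) j :
  (fun z => closest delta z 0 j) =
  (fun z : 'rV[R]_4 => z 0 j) - delta * (fun z => nrm0 delta z 0 j).
Proof.
apply/funext => z; transitivity (z 0 j - delta z * nrm0 delta z 0 j) => //.
by rewrite closestE; move: (nrm0 _ _) => n; rewrite !mxE.
Qed.

Lemma differentiable_closest (R : realType) (delta : 'rV[R]_4 -> R) z :
  differentiable delta z -> differentiable (nrm0 delta) z ->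
  differentiable (closest delta) z.
Proof.
move=> dd dn; apply: differentiable_rV => j; rewrite closest_coordE.
apply: differentiableB; first exact: differentiable_coord.
by apply: differentiableM => //; exact: differentiable_coord_comp.
Qed.

Lemma diff_closest (R : realType) (delta : 'rV[R]_4 -> R) z v :
  differentiable delta z -> differentiable (nrm0 delta) z ->
  'd (closest delta) z v =
  v - ('d delta z v *: nrm0 delta z + delta z *: 'd (nrm0 delta) z v).
Proof.
move=> dd dn; apply/rowP => j.
have dc := differentiable_closest dd dn.
have dnj := @differentiable_coord_comp _ _ _ _ z j dn.
have dvj (u : 'rV[R]_4) : differentiable (fun y : 'rV[R]_4 => y 0 j) u.
  exact: differentiable_coord.
rewrite diff_rV// closest_coordE -deriveE; last first.
  by apply: differentiableB => //; exact: differentiableM.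
rewrite deriveB ?deriveM ?(deriveE _ dd) ?(deriveE _ dnj); try exact: diff_derivable; last first.
  by apply: diff_derivable; exact: differentiableM.
have -> : 'D_v (fun y : 'rV[R]_4 => y 0 j) z = v 0 j.
  have idv : derivable (id : 'rV[R]_4 -> 'rV[R]_4) z v by exact: derivable_id.
  have := derive_mx idv.
  by rewrite derive_id => /(congr1 (fun M : 'rV__ => M 0 j)) ->; rewrite mxE.
rewrite [X in _ - X]addrC -diff_rV// in dnj *.
move: (nrm0 _ _) ('d (nrm0 _) _ _) => a b; rewrite !mxE.
by congr (_ - (_ + _)); rewrite [LHS]mulrC.
Qed.

(** On the zero level the sign of [phi] jumps and the Lipschitz argument fails. There the point is
    approached along the spatial gradient of [phi], where [phi] is nonzero for small r > 0, and
    |n|^2 passes to the limit by continuity. *)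
Lemma eikonal (R : realType) (Omega : set 'rV[R]_3) (T : R)
    (w : 'rV[R]_4 -> 'rV[R]_3) (phi : 'rV[R]_4 -> R) (U : set 'rV[R]_4)
    (delta : 'rV[R]_4 -> R) (kappa : 'I_2 -> 'rV[R]_4 -> R) z :
  evolving_surface Omega T w phi -> surface_neighborhood Omega T phi U ->
  projection_setting Omega T phi U delta kappa ->
  U z -> dot (nrm delta z) (nrm delta z) = 1.
Proof.
move=> hs hU hp Uz.
have [phiz|phiz] := eqVneq (phi z) 0; last first.
  by rewrite -sqr_enorm (eikonal_off_surface hs hU hp)// expr1n.
have [D [oD /(_ z Uz) Dz C2]] := delta_smooth hp.
have dn := differentiable_nrm C2 Dz.
have cn := differentiable_continuous (differentiable_dot_self dn).
have dphi : differentiable phi z.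
  by apply: (phi_differentiable hs); exact: (U_sub_cylinder hU).
set v := st (sgrad phi z) 0.
have phir : \forall r \near (0 : R)^'+, phi (z + r *: v) != 0.
  have [c [C [c0 /(_ z Uz)[/andP[+ _] _ _ _]]]] := level_set_bounds hU.
  move=> /(lt_le_trans c0) g0.
  have v0 : 0 < `|v| + 1 by rewrite ltr_wpDl.
  (* The derivative of [phi] along v is the squared length of its spatial gradient. This tolerance
     keeps the error along r v strictly below r times that square, so [phi] cannot vanish at z + r
     v. *)
  have e0 : 0 < enorm (sgrad phi z) ^+ 2 / (`|v| + 1) by rewrite divr_gt0// exprn_gt0.
  have A : \forall r \near (0 : R)^'+,
      `|phi (z + (0 + r *: v)) - phi z - 'd phi z (0 + r *: v)| <=
      enorm (sgrad phi z) ^+ 2 / (`|v| + 1) * `|0 + r *: v|.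
    exact: (@cvg_ray _ _ 0 v _ (diff_near dphi e0)).
  near=> r; have r0 : 0 < r by near: r; exact: nbhs_right_gt.
  have : `|phi (z + (0 + r *: v)) - phi z - 'd phi z (0 + r *: v)| <=
    enorm (sgrad phi z) ^+ 2 / (`|v| + 1) * `|0 + r *: v| by near: r.
  rewrite add0r phiz subr0 linearZ /= diff_st0// -sqr_enorm normrZ gtr0_norm//.
  rewrite mulrCA => h; apply: contraTneq h => ->; rewrite sub0r normrN -ltNge.
  rewrite normrM gtr0_norm// ltr_pM2l// ger0_norm ?sqr_ge0//.
  by rewrite -mulrA gtr_pMr ?exprn_gt0// mulrC ltr_pdivrMr// mul1r ltrDl.
have fr : \forall r \near (0 : R)^'+,
    dot (nrm delta (z + r *: v)) (nrm delta (z + r *: v)) = 1.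
  near=> r; rewrite -sqr_enorm (eikonal_off_surface hs hU hp) ?expr1n//.
    by near: r; exact: (neighborhood_horizontal_ray _ hs hU Uz).
  by near: r.
have lim := cvg_comp _ _ (@cvg_ray _ _ z v) cn.
apply/esym; apply: (cvg_unique _ _ lim) => //.
have : (fun=> 1 : R) @ (0 : R)^'+ --> (1 : R) by exact: cvg_cst.
by apply: cvg_trans; apply: near_eq_cvg; apply: filterS fr => r /= ->.
Unshelve. all: by end_near. Qed.

(** Half the derivative of the constant |n|^2; v may have a time component, so the relative openness
    of [U] at 0 and T matters. *)
Lemma dot_nrm_diff (R : realType) (Omega : set 'rV[R]_3) (T : R)
    (w : 'rV[R]_4 -> 'rV[R]_3) (phi : 'rV[R]_4 -> R) (U : set 'rV[R]_4)
    (delta : 'rV[R]_4 -> R) (kappa : 'I_2 -> 'rV[R]_4 -> R) z v :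
  evolving_surface Omega T w phi -> surface_neighborhood Omega T phi U ->
  projection_setting Omega T phi U delta kappa ->
  U z -> dot (nrm delta z) ('d (nrm delta) z v) = 0.
Proof.
move=> hs hU hp Uz; have [D' [oD' UE]] := neighborhood_open hU.
have [D [oD /(_ z Uz) Dz C2]] := delta_smooth hp.
have dn := differentiable_nrm C2 Dz.
have dd := differentiable_dot_self dn.
have Uz' := Uz; rewrite UE in Uz'.
have : 'd (fun y => dot (nrm delta y) (nrm delta y)) z v = 0.
  refine (@diff_eq0_relatively_open R Omega T D' _ _ (1 : R) z v (domain_open hs) oD'
    (final_time_gt0 hs) Uz' dd _).
  by rewrite -UE => y; exact: (eikonal hs hU hp).
by rewrite diff_dot_self// => /eqP; rewrite mulrn_eq0 /= => /eqP.
Qed.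

Lemma trmx_sjac_nrm (R : realType) (D : set 'rV[R]_4) (delta : 'rV[R]_4 -> R) z :
  open D -> Ck 2 D delta -> D z -> (sjac (nrm delta) z)^T = sjac (nrm delta) z.
Proof.
move=> oD C2 Dz; have dn := differentiable_nrm C2 Dz.
have coordE (i : 'I_3) : (fun x => nrm delta x 0 i) =
    'D_(st (delta_mx 0 i) 0) delta.
  by apply/funext => y; rewrite /nrm /sgrad /sp !mxE st_delta.
have E i j : sjac (nrm delta) z i j =
    'D_(st (delta_mx 0 j) 0) ('D_(st (delta_mx 0 i) 0) delta) z.
  by rewrite mxE derive_mx ?mxE ?coordE//; exact: diff_derivable.
by apply/matrixP => i j; rewrite mxE !E; exact: derive_comm oD C2 Dz.
Qed.

(** The transpose appears because ['J] acts on row vectors, whereas the rows of [sjac] are indexed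
    by the components of the field. *)
Lemma jacobian_nrm0 (R : realType) (delta : 'rV[R]_4 -> R) z :
  differentiable (nrm delta) z ->
  'J (nrm0 delta) z =
  block_mx (sjac (nrm delta) z)^T 0 (dt (nrm delta) z) 0 :> 'M[R]_(3 + 1).
Proof.
move=> dn; apply/matrixP => i j; rewrite mxE diff_nrm0//.
case: (split_ordP (i : 'I_(3 + 1))) (split_ordP (j : 'I_(3 + 1))) => i' -> [] j' ->.
- rewrite [RHS]block_mxEul st_lshift !mxE -st_delta.
  by rewrite deriveE.
- by rewrite [RHS]block_mxEur st_rshift mxE.
- by rewrite [RHS]block_mxEdl st_lshift ord1 -st_delta_max -deriveE.
- by rewrite [RHS]block_mxEdr st_rshift mxE.
Qed.

Lemma grad_blockE (R : realType) (delta : 'rV[R]_4 -> R) z :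
  grad delta z = st (nrm delta z) (dt delta z).
Proof.
rewrite -[grad delta z]stK; congr (st _ _); rewrite /tm mxE /dt st_delta_max.
by congr ('D_(delta_mx _ _) _ _); exact: val_inj.
Qed.

Lemma jacobian_closest (R : realType) (delta : 'rV[R]_4 -> R) z :
  differentiable delta z -> differentiable (nrm delta) z ->
  'J (closest delta) z = 1%:M - ((grad delta z)^T *m nrm0 delta z
                                 + delta z *: 'J (nrm0 delta) z).
Proof.
move=> dd dn; apply/row_matrixP => i.
have dn0 := differentiable_nrm0 dn.
rewrite !rowE mul_rV_jacobian diff_closest// mulmxBr mulmx1 mulmxDr -scalemxAr.
rewrite mul_rV_jacobian mulmxA mulmx_trE mul_scalar_mx diff_grad//.
Qed.

(** The added rank-one matrix cancels -n^T n in the spatial block and brings the sum into the shape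
    of [det_distance_block]. *)
Lemma jacobian_closest_block (R : realType) (delta : 'rV[R]_4 -> R) z :
  differentiable delta z -> differentiable (nrm delta) z ->
  'J (closest delta) z + (nrm0 delta z)^T *m grad delta z =
  block_mx (1%:M - delta z *: (sjac (nrm delta) z)^T)
    (dt delta z *: (nrm delta z)^T)
    (- dt delta z *: nrm delta z - delta z *: dt (nrm delta) z) 1%:M.
Proof.
move=> dd dn; rewrite jacobian_closest// jacobian_nrm0// grad_blockE.
set n := nrm delta z; set b := dt delta z; set c := dt (nrm delta) z.
have -> : (st n b)^T *m nrm0 delta z =
    block_mx (n^T *m n) 0 (b *: n) 0 :> 'M[R]_(3 + 1).
  rewrite /nrm0 /st -/n [(row_mx n _)^T](@tr_row_mx R 1 3 1).
  rewrite [LHS](@mul_col_row R 3 1 1 3 1) tr_scalar_mx !mul_scalar_mx.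
  by rewrite raddf0 mulmx0 scaler0.
have -> : (nrm0 delta z)^T *m st n b =
    block_mx (n^T *m n) (b *: n^T) 0 0 :> 'M[R]_(3 + 1).
  rewrite /nrm0 /st -/n [(row_mx n _)^T](@tr_row_mx R 1 3 1).
  rewrite [LHS](@mul_col_row R 3 1 1 3 1) tr_scalar_mx raddf0 !mul0mx.
  by rewrite mul_mx_scalar.
rewrite (@scalar_mx_block R 3 1 1) (@scale_block_mx R 3 1 3 1).
rewrite (@add_block_mx R 3 1 3 1) (@opp_block_mx R 3 1 3 1).
rewrite !(@add_block_mx R 3 1 3 1); congr (@block_mx R 3 1 3 1 _ _ _ _).
- by rewrite opprD addrA addrAC subrK.
- by rewrite scaler0 addr0 oppr0 !add0r.
- by rewrite addr0 add0r opprD scaleNr.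
- by rewrite scaler0 !addr0 oppr0 addr0.
Qed.

(** The pointwise facts on which the linear algebra rests, separated from the analysis that provides
    them on [U]. *)
Record level_geometry (R : realType) (delta : 'rV[R]_4 -> R) (z : 'rV[R]_4) :
    Prop := LevelGeometry {
  lg_delta : differentiable delta z ;
  lg_nrm : differentiable (nrm delta) z ;
  lg_unit : dot (nrm delta z) (nrm delta z) = 1 ;
  lg_orth : forall v, dot (nrm delta z) ('d (nrm delta) z v) = 0 ;
  lg_sym : (sjac (nrm delta) z)^T = sjac (nrm delta) z }.

Lemma U_level_geometry (R : realType) (Omega : set 'rV[R]_3) (T : R)
    (w : 'rV[R]_4 -> 'rV[R]_3) (phi : 'rV[R]_4 -> R) (U : set 'rV[R]_4)
    (delta : 'rV[R]_4 -> R) (kappa : 'I_2 -> 'rV[R]_4 -> R) z :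
  evolving_surface Omega T w phi -> surface_neighborhood Omega T phi U ->
  projection_setting Omega T phi U delta kappa ->
  U z -> level_geometry delta z.
Proof.
move=> hs hU hp Uz; have [D [oD /(_ z Uz) Dz C2]] := delta_smooth hp.
split; first exact: C2.1.
- exact: differentiable_nrm C2 Dz.
- exact: (eikonal hs hU hp).
- by move=> v; exact: (dot_nrm_diff _ hs hU hp).
- exact: trmx_sjac_nrm oD C2 Dz.
Qed.

Lemma nrm_mul_sjac (R : realType) (delta : 'rV[R]_4 -> R) z :
  level_geometry delta z -> nrm delta z *m sjac (nrm delta) z = 0.
Proof.
move=> lg; apply/rowP => j; rewrite [LHS]mxE [RHS]mxE -[RHS](lg_orth lg (st (delta_mx 0 j) 0)).
by apply: eq_bigr => i _; rewrite [sjac _ _ _ _]mxE deriveE//; exact: lg_nrm.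
Qed.

(** With N the gradient of [delta], the component of the image of v along N is N.v - (N.v)(n_0.N) -
    delta (dn_0(v).N), where n_0.N = |n|^2 = 1 and dn_0(v).N = dn(v).n = 0. *)
Lemma jacobian_closest_tr_grad (R : realType) (delta : 'rV[R]_4 -> R) z :
  level_geometry delta z -> 'J (closest delta) z *m (grad delta z)^T = 0.
Proof.
move=> lg; have [dd dn u o _] := lg; apply/row_matrixP => i.
rewrite row0 rowE mulmxA mul_rV_jacobian mulmx_trE diff_closest//; last first.
  exact: differentiable_nrm0.
rewrite dotDl -scaleN1r dotZl dotDl !dotZl -diff_grad//.
rewrite diff_nrm0// grad_blockE !dot_st !spst !tmst !mul0r !addr0.
by rewrite u dotC o mulr0 addr0 mulr1 mulN1r subrr raddf0.
Qed.

(** The symmetry of H enters here: ['J (nrm0 delta)] contains H^T, while differentiating |n|^2 = 1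
    gives n H = 0. *)
Lemma nrm0_mul_jacobian_closest (R : realType) (delta : 'rV[R]_4 -> R) z :
  level_geometry delta z -> nrm0 delta z *m 'J (closest delta) z = 0.
Proof.
move=> lg; have [dd dn u _ s] := lg.
have n0N : dot (nrm0 delta z) (grad delta z) = 1.
  by rewrite grad_blockE dot_st !spst !tmst mul0r addr0 u.
rewrite jacobian_closest// mulmxBr mulmx1 mulmxDr -scalemxAr mulmxA mulmx_trE.
rewrite n0N mul1mx jacobian_nrm0// /nrm0 /st.
rewrite [X in _ - (_ + _ *: X)](@mul_row_block R 1 3 1 3 1).
rewrite !mulmx0 raddf0 mul0mx !addr0 s nrm_mul_sjac//.
by rewrite (@row_mx0 R 1 3 1) scaler0 addr0 subrr.
Qed.

Lemma det_jacobian_closest (R : realType) (delta : 'rV[R]_4 -> R) z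
    (k : 'I_2 -> R) :
  level_geometry delta z ->
  char_poly (sjac (nrm delta) z) = 'X * \prod_(i < 2) ('X - (k i)%:P) ->
  \det ('J (closest delta) z + (nrm0 delta z)^T *m grad delta z) =
  \prod_(i < 2) (1 - delta z * k i) * (1 + dt delta z ^+ 2).
Proof.
move=> lg ck; have [dd dn u o _] := lg.
rewrite jacobian_closest_block// -(det_sub_scale _ ck).
apply: (@det_distance_block R 3); first exact: nrm_mul_sjac.
  by rewrite mulmx_trE u.
by rewrite mulmx_trE /dt deriveE// o raddf0.
Qed.

(* Applied to [F = grad phi (closest delta z)]: differentiating [phi \o closest
   delta = 0] gives the last hypothesis. *)
Lemma tr_grad_parallel (R : realType) (delta : 'rV[R]_4 -> R) z
    (k : 'I_2 -> R) (F : 'rV[R]_4) :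
  level_geometry delta z ->
  char_poly (sjac (nrm delta) z) = 'X * \prod_(i < 2) ('X - (k i)%:P) ->
  (forall i, 0 < 1 - delta z * k i) ->
  'J (closest delta) z *m F^T = 0 -> exists a, F = a *: grad delta z.
Proof.
move=> lg ck kp PF; set N := grad delta z; set n0 := nrm0 delta z.
have NN : dot N N = 1 + dt delta z ^+ 2.
  by rewrite /N grad_blockE dot_st !spst !tmst lg_unit// expr2.
have NN0 : 0 < dot N N by rewrite NN ltr_wpDr// sqr_ge0.
(* [W] maps both F^T and N^T to multiples of n_0^T, so its invertibility makes F and N parallel. *)
set W := 'J (closest delta) z + n0^T *m N.
have Wu : W \in unitmx.
  rewrite unitmxE (det_jacobian_closest lg ck) unitfE mulf_neq0//.
    by apply/prodf_neq0 => i _; rewrite gt_eqF.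
  by rewrite -NN gt_eqF.
exists (dot N F / dot N N); apply: trmx_inj; rewrite linearZ /=.
apply: (can_inj (mulKmx Wu)); rewrite -scalemxAr !mulmxDl PF.
rewrite jacobian_closest_tr_grad// !add0r -!mulmxA !mulmx_trE.
rewrite !mul_mx_scalar scalerA -mulrA mulVf ?mulr1//.
by rewrite gt_eqF.
Qed.

(** The right side is the squared length of [grad delta z]. If the gradient of [phi] at the foot
    point is a times that vector, the transport equation gives w . grad phi = -a delta_t; dividing
    by |a|, the length of the spatial gradient, and squaring removes a. *)
Lemma alpha_closest (R : realType) (Omega : set 'rV[R]_3) (T : R)
    (w : 'rV[R]_4 -> 'rV[R]_3) (phi : 'rV[R]_4 -> R) (U : set 'rV[R]_4)
    (delta : 'rV[R]_4 -> R) (kappa : 'I_2 -> 'rV[R]_4 -> R) z :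
  evolving_surface Omega T w phi -> surface_neighborhood Omega T phi U ->
  projection_setting Omega T phi U delta kappa ->
  U z -> (forall i, 0 < 1 - delta z * kappa i z) ->
  alpha w phi (closest delta z) ^+ 2 = 1 + dt delta z ^+ 2.
Proof.
move=> hs hU hp Uz kp.
have lg := U_level_geometry hs hU hp Uz.
have dn0 := differentiable_nrm0 (lg_nrm lg).
have dc := differentiable_closest (lg_delta lg) dn0.
have Spz := proj_to_S hp Uz; set p := closest delta z in Spz *.
have Up : U p := neighborhood_sub hU Spz.
have cp := U_sub_cylinder hU Up.
have dphi := phi_differentiable hs cp.
have [D' [oD' UE]] := neighborhood_open hU.
have [a Fa] : exists a, grad phi p = a *: grad delta z.
  apply: (tr_grad_parallel lg (kappa_eigenvalues hp Uz) kp).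
  apply/row_matrixP => i; rewrite row0 rowE mulmxA mul_rV_jacobian mulmx_trE.
  rewrite -diff_grad//.
  have dpc : differentiable (phi \o closest delta) z by exact: differentiable_comp.
  have Uz' := Uz; rewrite UE in Uz'.
  have H : 'd (phi \o closest delta) z (delta_mx 0 i) = 0.
    refine (@diff_eq0_relatively_open R Omega T D' _ _ (0 : R) z _ (domain_open hs) oD'
      (final_time_gt0 hs) Uz' dpc _).
    rewrite -UE => y /(proj_to_S hp)[_ [_]] /=; by rewrite stK.
  have -> : 'd phi p ('d (closest delta) z (delta_mx 0 i)) = 0.
    by rewrite -H; exact: (esym (congr1 (fun f => f (delta_mx 0 i)) (diff_comp dc dphi))).
  by rewrite raddf0.
rewrite /alpha sqr_sqrtr ?addr_ge0 ?sqr_ge0//; congr (1 + _).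
have [c [C [c0 /(_ p Up)[/andP[+ _] _ _ _]]]] := level_set_bounds hU.
move=> /(lt_le_trans c0) g0.
have := transport hs cp.
have -> : dt phi p = a * dt delta z.
  by have := congr1 (@tm R) Fa; rewrite tmZ !grad_blockE !tmst.
move=> /eqP; rewrite addr_eq0 => /eqP h.
rewrite /normal_velocity /normal_on_S dotZr.
have := sqr_enorm (sgrad phi p).
have sg : sgrad phi p = a *: nrm delta z.
  by rewrite {1}/sgrad Fa spZ.
rewrite {2 3}sg dotZl dotZr lg_unit// mulr1 => g2.
have -> : dot (w p) (sgrad phi p) = - (a * dt delta z) by rewrite h opprK.
have a0 : a != 0.
  apply: contraTneq g0 => a0; move/eqP: g2.
  by rewrite a0 mul0r sqrf_eq0 => /eqP ->; rewrite ltxx.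
by rewrite exprMn exprVn g2 sqrrN; field.
Qed.

Lemma jacobian_comp (R : realType) m n p (f : 'rV[R]_m -> 'rV[R]_n)
    (g : 'rV[R]_n -> 'rV[R]_p) x :
  differentiable f x -> differentiable g (f x) ->
  'J (g \o f) x = 'J f x *m 'J g (f x).
Proof.
move=> df dg; apply/row_matrixP => i; rewrite !rowE mulmxA !mul_rV_jacobian.
exact: (congr1 (fun h => h (delta_mx 0 i)) (diff_comp df dg)).
Qed.

Lemma gram_closest (R : realType) (Omega : set 'rV[R]_3) (T : R)
    (w : 'rV[R]_4 -> 'rV[R]_3) (phi : 'rV[R]_4 -> R) (U : set 'rV[R]_4)
    (delta : 'rV[R]_4 -> R) (kappa : 'I_2 -> 'rV[R]_4 -> R)
    (X : 'rV[R]_3 -> 'rV[R]_4) y (nu : 'rV[R]_4) :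
  evolving_surface Omega T w phi -> surface_neighborhood Omega T phi U ->
  projection_setting Omega T phi U delta kappa ->
  differentiable X y -> 0 < gram X y -> U (X y) ->
  (forall i, 0 < 1 - delta (X y) * kappa i (X y)) ->
  enorm nu = 1 -> 'J X y *m nu^T = 0 -> 0 < dot (nrm0 delta (X y)) nu ->
  gram (closest delta \o X) y =
  gram X y * (extension delta (alpha w phi) (X y) * dot (nrm0 delta (X y)) nu *
           \prod_(i < 2) (1 - delta (X y) * kappa i (X y))).
Proof.
move=> hs hU hp dX g0 Uz kp nu1 Anu n0nu; set z := X y in Uz kp n0nu *.
have lg := U_level_geometry hs hU hp Uz.
have dn0 := differentiable_nrm0 (lg_nrm lg).
have dc : differentiable (closest delta) (X y).
  exact: differentiable_closest (lg_delta lg) dn0.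
have J : 'J (closest delta \o X) y = 'J X y *m 'J (closest delta) z.
  exact: jacobian_comp.
have prod_gt0 : 0 < \prod_(i < 2) (1 - delta z * kappa i z) by exact: prodr_gt0.
have alpha0 : 0 <= extension delta (alpha w phi) z by exact: sqrtr_ge0.
have det0 : 0 < \det ('J X y *m ('J X y)^T) by rewrite -sqrtr_gt0.
set N := grad delta z.
have NN : dot N N = 1 + dt delta z ^+ 2.
  by rewrite /N grad_blockE dot_st !spst !tmst lg_unit// expr2.
have NN0 : 0 < dot N N by rewrite NN ltr_wpDr// sqr_ge0.
(* The determinant formula produces (1 + delta_t^2)^2 on the right. One power cancels against N.N,
   the other is the square of alpha at the foot point. *)
have detE : \det ('J X y *m 'J (closest delta) z *m ('J X y *m 'J (closest delta) z)^T) =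
   \det ('J X y *m ('J X y)^T) * (extension delta (alpha w phi) z *
    dot (nrm0 delta z) nu * \prod_(i < 2) (1 - delta z * kappa i z)) ^+ 2.
  apply: (mulIf (lt0r_neq0 NN0)).
  have := @det_gram_mulmx R 3 1 ('J X y) ('J (closest delta) z) (nrm0 delta z) nu N.
  rewrite !mulmx_trE -sqr_enorm nu1 expr1n Anu nrm0_mul_jacobian_closest//.
  have -> : dot (nrm0 delta z) (nrm0 delta z) = 1.
    by rewrite /nrm0 dot_st !spst !tmst lg_unit// mulr0 addr0.
  rewrite jacobian_closest_tr_grad// (lt0r_neq0 det0).
  move=> /(_ erefl erefl erefl erefl erefl isT).
  rewrite !det_scalar1 (det_jacobian_closest lg (kappa_eigenvalues hp Uz)) => ->.
  rewrite !exprMn (alpha_closest hs hU hp Uz kp) -NN; ring.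
rewrite /gram J detE sqrtrM; last exact: ltW.
by rewrite sqrtr_sqr ger0_norm// !mulr_ge0// ltW.
Qed.

(** * Null sets *)

Lemma lebesgue_measure_shift (R : realType) (r : R) (A : set (measurableTypeR R)) :
  measurable A -> lebesgue_measure ((fun x : R => x + r) @^-1` A) =
  lebesgue_measure A.
Proof.
move=> mA.
pose f : measurableTypeR R -> measurableTypeR R := fun x => x + r.
have mf : measurable_fun [set: measurableTypeR R] f by exact: measurable_funD.
pose mfM := isMeasurableFun.Build _ _ _ _ f mf.
pose F : {mfun measurableTypeR R >-> measurableTypeR R} := HB.pack f mfM.
rewrite [RHS](@lebesgue_measure_unique R (pushforward lebesgue_measure F))//.
move=> _ [[a b]] _ <-.
change (lebesgue_measure `]a, b]%classic = lebesgue_measure (f @^-1` `]a, b]%classic)).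
rewrite [X in _ = _ X](_ : _ = `]a - r, b - r]%classic).
  by rewrite !lebesgue_measure_itv /= !lte_fin ltrD2r -!EFinD opprB addrA subrK.
by apply/seteqP; split => x /=; rewrite !in_itv /= /f ltrBlDr lerBrDr.
Qed.

(* The translates of [S] by the numbers [e / n] are pairwise disjoint. *)
Lemma lebesgue_measure0_disjoint_shifts (R : realType) (e : R)
    (S : set (measurableTypeR R)) :
  0 < e -> measurable S ->
  (forall s i j, S s -> (i < j)%N -> ~ S (s + (e / i.+1%:R - e / j.+1%:R))) ->
  lebesgue_measure S = 0%E.
Proof.
move=> e0 mS hS; apply/negligibleP => //.
have -> : S = \bigcup_k (S `&` `[- k%:R, k%:R]).
  rewrite -setI_bigcupr (_ : \bigcup_k _ = setT) ?setIT//.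
  apply/seteqP; split => // x _; have [k xk] : exists k : nat, `|x| <= k%:R.
    by exists (Num.bound `|x|); rewrite ltW// archi_boundP.
  by exists k => //=; rewrite in_itv /= -ler_norml.
apply: negligible_bigcup => k; set A := _ `&` _.
have mA : measurable A by apply: measurableI => //; exact: measurable_itv.
apply/negligibleP => //.
pose F i := (fun x : R => x + - (e / i.+1%:R)) @^-1` A.
have mF i : measurable (F i).
  by rewrite -[F i]setTI; apply: measurable_funD.
have FA i : lebesgue_measure (F i) = lebesgue_measure A.
  exact: lebesgue_measure_shift.
have step i j x : (i < j)%N -> F i x -> F j x -> False.
  move=> ij [Si _] [Sj _]; apply: (hS _ _ _ Si ij); move: Sj.
  by rewrite /= addrA subrK.
have tF : trivIset setT F.
  apply/trivIsetP => i j _ _ ij; apply/seteqP; split => // x [Fi Fj].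
  move: ij; rewrite neq_ltn => /orP[] ij; [exact: (step i j x)|exact: (step j i x)].
(* The shifts e / (i+1) lie between 0 and e, so all translates of a subset of [-k, k] stay in
   [-k, k + e]. *)
have bound n : (n%:R%:E * lebesgue_measure A <= (2 * k%:R + e)%:E)%E.
  have <- : lebesgue_measure (\big[setU/set0]_(i < n) F i) =
      (n%:R%:E * lebesgue_measure A)%E.
    rewrite measure_bigsetU//.
    rewrite (eq_bigr (fun=> lebesgue_measure A)) => [|i _]; last exact: FA.
    by rewrite sumr_const card_ord mule_natl.
  have -> : (2 * k%:R + e)%:E = lebesgue_measure `[- k%:R, k%:R + e]%classic.
    rewrite lebesgue_measure_itv /= lte_fin ifT; last first.
      by have := ler0n R k; lra.
    by congr EFin; ring.
  apply: le_measure; rewrite ?inE//=.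
    by apply: bigsetU_measurable => i _; exact: mF.
  move=> x; rewrite -bigcup_mkord => -[i _ [_]] /=; rewrite !in_itv /=.
  have ie0 : 0 <= e / i.+1%:R by rewrite divr_ge0// ltW.
  have ie : e / i.+1%:R <= e by rewrite ler_pdivrMr// ler_peMr ?ler1n// ltW.
  move: (e / _) ie0 ie => t t0 te /andP[h1 h2]; apply/andP; split; lra.
have Afin : lebesgue_measure A \is a fin_num.
  rewrite ge0_fin_numE//; have := bound 1%N; rewrite mul1e => /le_lt_trans; apply.
  exact: ltry.
have [c cE] : exists c, lebesgue_measure A = c%:E.
  by exists (fine (lebesgue_measure A)); rewrite fineK.
have c0 : 0 <= c by rewrite -lee_fin -cE.
apply: (etrans cE); congr (_%:E); apply/eqP; rewrite eq_le c0 andbT leNgt; apply/negP => cp.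
have B0 : 0 <= (2 * k%:R + e) / c by rewrite divr_ge0// addr_ge0// ltW.
have := bound (Num.bound ((2 * k%:R + e) / c)).
rewrite cE -EFinM lee_fin; apply/negP; rewrite -ltNge -ltr_pdivrMr//.
exact: archi_boundP.
Qed.

Definition shift3 (R : realType) (i : 'I_3) (r : R)
    (y : measurableTypeR R * measurableTypeR R * measurableTypeR R) :
    measurableTypeR R * measurableTypeR R * measurableTypeR R :=
  ((y.1.1 + r * (i == 0)%:R, y.1.2 + r * (i == 1)%:R), y.2 + r * (i == 2)%:R).

Lemma vec3_shift3 (R : realType) (i : 'I_3) (r : R) y :
  vec3 (shift3 i r y) = vec3 y + r *: delta_mx 0 i.
Proof.
by apply/rowP => j; rewrite !mxE eqxx /=; case: j => [[|[|[|]]]] // hj /=;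
  rewrite eq_sym.
Qed.

Lemma measurable_shift3 (R : realType) (i : 'I_3) (r : R) :
  measurable_fun setT (@shift3 R i r).
Proof.
have m1 : measurable_fun setT 
    (fst : measurableTypeR R * measurableTypeR R * measurableTypeR R -> _).
  exact: measurable_fst.
apply: measurable_fun_pair.
  apply: measurable_fun_pair; apply: measurable_funD => //.
    exact: measurableT_comp measurable_fst m1.
  exact: measurableT_comp measurable_snd m1.
by apply: measurable_funD => //; exact: measurable_snd.
Qed.

(** The product measure is defined by integrating x-sections; uniqueness identifies it with the
    iterated integral in the other order. *)
Lemma product_measure_ysection0 d1 d2 (T1 : measurableType d1)
    (T2 : measurableType d2) (R : realType)
    (m1 : {sigma_finite_measure set T1 -> \bar R})
    (m2 : {sigma_finite_measure set T2 -> \bar R}) (E : set (T1 * T2)) :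
  measurable E -> (forall y, m1 (ysection E y) = 0%E) -> (m1 \x m2)%E E = 0%E.
Proof.
move=> mE E0; transitivity ((m1 \x^ m2)%E E).
  by apply: product_measure_unique => //= A B mA mB; exact: product_measure2E.
by apply: integral0_eq => y _; exact: E0.
Qed.

Definition cube (R : realType) (k : nat) : set (measurableTypeR R) :=
  `[- k%:R, k%:R]%classic.

Lemma measurable_cube (R : realType) k : measurable (@cube R k).
Proof. exact: measurable_itv. Qed.

Lemma lebesgue_measure_cube (R : realType) k :
  (lebesgue_measure (@cube R k) < +oo)%E.
Proof. by rewrite lebesgue_measure_itv /=; case: ifP => _; exact: ltry. Qed.

Lemma bigcup_cube (R : realType) : \bigcup_k @cube R k = setT.
Proof.
apply/seteqP; split => // x _; exists (Num.bound `|x|) => //=.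
by rewrite /cube /= in_itv /= -ler_norml ltW// archi_boundP.
Qed.

Lemma cubeS (R : realType) i j : (i <= j)%N -> @cube R i `<=` @cube R j.
Proof.
move=> ij x; rewrite /cube /= !in_itv /= => /andP[h1 h2].
have ij' : i%:R <= j%:R :> R by rewrite ler_nat.
by apply/andP; split; lra.
Qed.

Lemma leb2_sigma_finite (R : realType) : sigma_finite setT (leb2 R).
Proof.
exists (fun k => cube k `*` cube k).
  apply/seteqP; split => // -[x y] _.
  have [] : setT x /\ setT y by [].
  rewrite -bigcup_cube => -[i _ ix] [j _ jy]; exists (maxn i j) => //; split => /=.
    exact: (cubeS (leq_maxl i j)).
  exact: (cubeS (leq_maxr i j)).
move=> k; have mk := @measurable_cube R k; split; first exact: measurableX.
rewrite product_measure1E//; apply: lte_mul_pinfty => //.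
  by rewrite ge0_fin_numE//; exact: lebesgue_measure_cube.
exact: lebesgue_measure_cube.
Qed.

(** Fubini: every line parallel to axis i meets [E] in a null set, by the one-dimensional case. For
    axis 2 the lines are x-sections of the outer product; for the other axes the last coordinate is
    fixed first, which calls for sigma-finiteness of [leb2]. *)
Lemma leb3_disjoint_shifts (R : realType) (e : R) (i : 'I_3)
    (E : set (measurableTypeR R * measurableTypeR R * measurableTypeR R)) :
  0 < e -> measurable E ->
  (forall y a b, E y -> (a < b)%N ->
     ~ E (shift3 i (e / a.+1%:R - e / b.+1%:R) y)) ->
  leb3 R E = 0%E.
Proof.
move=> e0 mE hE.
have [i2|i2] := eqVneq i 2.
  apply: integral0_eq => x _; apply: (lebesgue_measure0_disjoint_shifts e0).
    exact: measurable_xsection.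
  move=> s a b; rewrite /xsection /= !inE => Es ab.
  have := hE _ _ _ Es ab; rewrite /shift3 i2 /= !mulr0 !addr0 mulr1.
  by rewrite -surjective_pairing.
have leb2_null (A : set (measurableTypeR R * measurableTypeR R)) : measurable A ->
    (forall y, lebesgue_measure (ysection A y) = 0%E) -> leb2 R A = 0%E.
  exact: product_measure_ysection0.
pose sfM := Measure_isSigmaFinite.Build _ _ _ (leb2 R) (@leb2_sigma_finite R).
pose m2 : {sigma_finite_measure set (measurableTypeR R * measurableTypeR R)%type -> \bar R} :=
  HB.pack (leb2 R) sfM.
apply: (@product_measure_ysection0 _ _ _ _ R m2 (@lebesgue_measure R) E mE) => z.
have mEz : measurable (ysection E z) by exact: measurable_ysection.
have [i1|i1] := eqVneq i 1.
  apply: integral0_eq => x _; apply: (lebesgue_measure0_disjoint_shifts e0).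
    exact: measurable_xsection.
  move=> s a b; rewrite /xsection /ysection /= !inE /= !inE => Es ab.
  by have := hE _ _ _ Es ab; rewrite /shift3 i1 /= !mulr0 !addr0 mulr1.
have i0 : i = 0.
  by apply/val_inj; case: i i1 i2 {hE} => [[|[|[|]]]].
apply: (leb2_null _ mEz) => x.
apply: (lebesgue_measure0_disjoint_shifts e0).
  exact: measurable_ysection.
move=> s a b; rewrite /ysection /= !inE /= !inE => Es ab.
by have := hE _ _ _ Es ab; rewrite /shift3 i0 /= !mulr0 !addr0 mulr1.
Qed.

(** * Borel images of patches *)

Lemma open_bigcup_compact (R : realType) n (D : set 'rV[R]_n) : open D ->
  exists C : nat -> set 'rV[R]_n, (forall k, compact (C k)) /\ D = \bigcup_k C k.
Proof.
(* Requiring an open ball of fixed radius to stay in [D] is a closed condition, unlike membership in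
   [D]. *)
move=> oD; exists (fun k => [set x | `|x| <= k%:R /\
    forall y, `|x - y| < k.+1%:R^-1 -> D y]); split=> [k|].
  apply: bounded_closed_compact.
    exists k%:R; split; first exact: num_real.
    by move=> M kM x [xk _]; exact: le_trans xk (ltW kM).
  move=> x clx; split.
    apply/ler_addgt0Pr => e e0.
    have [y [[yk _] xy]] := clx _ (nbhsx_ballx x e e0).
    rewrite -[x](subrK y) (le_trans (ler_normD _ _))// addrC lerD//.
    by move: xy; rewrite -ball_normE /= => /ltW.
  move=> y xy; have e0 : 0 < k.+1%:R^-1 - `|x - y| by rewrite subr_gt0.
  have [x' [[_ x'D] xx']] := clx _ (nbhsx_ballx x _ e0).
  apply: x'D; rewrite -[x'](subrK x) -addrA.
  rewrite (le_lt_trans (ler_normD _ _))// -ltrBrDr distrC.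
  by move: xx'; rewrite -ball_normE /=.
apply/seteqP; split=> [x Dx|x [k _ [_ +]]]; last first.
  by apply; rewrite subrr normr0 invr_gt0.
have /nbhs_ballP[r /= r0 hr] := open_nbhs_nbhs (conj oD Dx).
have x0 := Num.Theory.archi_boundP (normr_ge0 x).
have i0 : 0 <= r^-1 by rewrite invr_ge0 ltW.
have ir := Num.Theory.archi_boundP i0.
exists (maxn (Num.bound `|x|) (Num.bound r^-1)) => //; split.
  by rewrite (le_trans (ltW x0))// ler_nat leq_maxl.
move=> y xy; apply: hr; rewrite -ball_normE /=; apply: (lt_le_trans xy).
rewrite -[leRHS]invrK lef_pV2 ?posrE ?invr_gt0//.
by rewrite (le_trans (ltW ir))// ler_nat (leq_trans (leq_maxr (Num.bound `|x|) _)).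
Qed.

Lemma compact_measurable (R : realType) (K : set 'rV[R]_4) :
  compact K -> measurable (K : set (borel4 R)).
Proof.
move=> cK; rewrite -[K]setCK; apply: measurableC; apply: sub_sigma_algebra.
by apply: closed_openC; apply: compact_closed => //; exact: norm_hausdorff.
Qed.

Lemma image_open_measurable (R : realType) n (D : set 'rV[R]_n)
    (f : 'rV[R]_n -> 'rV[R]_4) :
  open D -> (forall x, D x -> {for x, continuous f}) ->
  measurable (f @` D : set (borel4 R)).
Proof.
move=> oD cf; have [C [cC DE]] := open_bigcup_compact oD.
rewrite DE image_bigcup; apply: bigcup_measurable => k _.
apply: compact_measurable; apply: continuous_compact => //.
apply: continuous_in_subspaceT => x; rewrite inE => Cx; apply: cf.
by rewrite DE; exists k.
Qed.

Notation R3 R := (measurableTypeR R * measurableTypeR R * measurableTypeR R)%type.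

Definition unvec3 (R : realType) (x : 'rV[R]_3) : R3 R := ((x 0 0, x 0 1), x 0 2).

Lemma unvec3K (R : realType) : cancel (@unvec3 R) (@vec3 R).
Proof.
move=> x; apply/rowP => j; rewrite mxE.
by case: j => [[|[|[|]]]] //= hj; congr (x 0 _); exact: val_inj.
Qed.

Lemma vec3K (R : realType) : cancel (@vec3 R) (@unvec3 R).
Proof. by move=> [[a b] c]; rewrite /unvec3 !mxE. Qed.

Lemma rV_norm_ltP (R : realType) n (x : 'rV[R]_n) (e : R) :
  0 < e -> `|x| < e <-> forall j, `|x 0 j| < e.
Proof.
move=> e0; rewrite {1}/Num.Def.normr /= mx_normrE; split.
  by move=> /bigmax_ltP[_ h] j; exact: (h (0, j)).
by move=> h; apply/bigmax_ltP; split => // -[i j] _; rewrite /= ord1.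
Qed.

(** The sigma-algebra on triples is generated by rectangles. In the sup norm balls are boxes, and
    countably many rational ones exhaust an open set. *)
Lemma vec3_open_measurable (R : realType) (D : set 'rV[R]_3) :
  open D -> measurable ((fun y : R3 R => vec3 y) @^-1` D).
Proof.
move=> oD.
pose P (q : rat * rat * rat * nat) : set 'rV[R]_3 :=
  ball (\row_(i < 3) (ratr (nth 0 [:: q.1.1.1; q.1.1.2; q.1.2] i) : R)) q.2.+1%:R^-1.
have -> : (fun y : R3 R => vec3 y) @^-1` D =
   (* The constant set is everything or empty, and so selects the balls contained in [D]. *)
   \bigcup_q ((fun y : R3 R => vec3 y) @^-1` (P q `&` [set _ | P q `<=` D])).
  apply/seteqP; split=> [y Dy|y [q _ [Pqy]]]; last exact.
  have /nbhs_ballP[r /= r0 hr] := open_nbhs_nbhs (conj oD Dy).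
  have i0 : 0 <= (r / 2)^-1 by rewrite invr_ge0 divr_ge0// ltW.
  have := archi_boundP i0; set k := Num.bound _ => hk.
  have k0 : 0 < k.+1%:R^-1 :> R by rewrite invr_gt0.
  (* One radius for the distance from y to the rational centre, one for the ball around that
     centre. *)
  have kr : k.+1%:R^-1 + k.+1%:R^-1 < r.
    have : k.+1%:R^-1 < r / 2.
      rewrite -[ltRHS]invrK ltf_pV2 ?posrE ?invr_gt0 ?divr_gt0//.
      by rewrite (lt_le_trans hk)// ler_nat.
    by move=> h; rewrite [ltRHS]splitr ltrD.
  have ratq (a : R) : exists q : rat, `|a - ratr q| < k.+1%:R^-1.
    have ae : a < a + k.+1%:R^-1 by rewrite ltrDl.
    have [q] := rat_in_itvoo ae; rewrite in_itv /= => /andP[h1 h2].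
    by exists q; rewrite distrC gtr0_norm ?subr_gt0// ltrBlDl.
  have [q1 h1] := ratq y.1.1; have [q2 h2] := ratq y.1.2; have [q3 h3] := ratq y.2.
  have Pqy : P (q1, q2, q3, k) (vec3 y).
    rewrite /P /= -ball_normE /= distrC; apply/rV_norm_ltP => // j.
    by rewrite !mxE; case: j => [[|[|[|]]]].
  exists (q1, q2, q3, k) => //; split => //= x Pqx; apply: hr.
  rewrite -ball_normE /= (lt_trans _ kr)// .
  move: Pqy Pqx; rewrite /P /= -!ball_normE /=; set c := \row_i _ => A B.
  rewrite -[_ - x](subrKA c) (le_lt_trans (ler_normD _ _))// ltrD//.
  by rewrite distrC.
apply: countable_bigcupT_measurable => [|q]; first exact: countableP.
rewrite preimage_setI; apply: measurableI; last first.
  have [h|h] := pselect (P q `<=` D).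
    by rewrite (_ : _ @^-1` _ = setT)//; apply/seteqP; split.
  by rewrite (_ : _ @^-1` _ = set0)//; apply/seteqP; split.
set r : R := q.2.+1%:R^-1.
have r0 : 0 < r by rewrite invr_gt0.
have -> : (fun y : R3 R => vec3 y) @^-1` P q =
    ((`]ratr q.1.1.1 - r, ratr q.1.1.1 + r[%classic `*`
      `]ratr q.1.1.2 - r, ratr q.1.1.2 + r[%classic) `*`
      `]ratr q.1.2 - r, ratr q.1.2 + r[%classic).
  have itvE (a b : R) : (`|a - b| < r) = (b \in `]a - r, a + r[).
    by rewrite in_itv /= distrC ltr_distl.
  apply/seteqP; split=> y; rewrite /P /= -ball_normE /=.
    move=> /(rV_norm_ltP _ r0) h; have := h 2; have := h 1; have := h 0.
    by rewrite !mxE /= !itvE.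
  move=> [[h0 h1] h2]; apply/(rV_norm_ltP _ r0) => j.
  by rewrite !mxE; case: j => [[|[|[|]]]] //= _; rewrite itvE.
by apply: measurableX; [apply: measurableX|]; exact: measurable_itv.
Qed.

Lemma open_setI_preimage (T U : topologicalType) (D : set T) (V : set U)
    (f : T -> U) :
  open D -> open V -> (forall x, D x -> {for x, continuous f}) ->
  open (D `&` f @^-1` V).
Proof.
move=> oD oV cf; rewrite openE => x [Dx Vfx]; apply: filterI.
  by apply: open_nbhs_nbhs.
by apply: (cf x Dx); apply: open_nbhs_nbhs.
Qed.

Lemma measurable_fun_vec3 (R : realType) (D : set 'rV[R]_3)
    (X : 'rV[R]_3 -> 'rV[R]_4) :
  open D -> (forall x, D x -> {for x, continuous X}) ->
  measurable_fun ((fun y : R3 R => vec3 y) @^-1` D)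
    (fun y : R3 R => X (vec3 y) : borel4 R).
Proof.
move=> oD cX; apply: (@measurability _ _ _ (borel4 R) _ _ (@open 'rV[R]_4)) => //.
move=> _ [V oV <-]; apply: (@vec3_open_measurable R (D `&` X @^-1` V)).
exact: open_setI_preimage.
Qed.

Lemma measurable_fun_vec3_real (R : realType) (D : set 'rV[R]_3)
    (f : 'rV[R]_3 -> R) :
  open D -> (forall x, D x -> {for x, continuous f}) ->
  measurable_fun ((fun y : R3 R => vec3 y) @^-1` D) (fun y : R3 R => f (vec3 y)).
Proof.
move=> oD cf; apply: (measurability _ (RGenOInfty.measurableE R)).
move=> _ [_ [a ->] <-]; apply: (@vec3_open_measurable R (D `&` f @^-1` `]a, +oo[)).
by apply: open_setI_preimage => //; exact: interval_open.
Qed.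

(* The coordinates of the inverse of [X] are Borel, because [X] maps open sets to
   countable unions of compact sets; so no descriptive set theory is needed. *)
Lemma image_vec3_measurable (R : realType) (D : set 'rV[R]_3)
    (X : 'rV[R]_3 -> 'rV[R]_4) (B : set (R3 R)) :
  open D -> (forall x, D x -> {for x, continuous X}) -> {in D &, injective X} ->
  measurable B -> (forall y, B y -> D (vec3 y)) ->
  measurable ((fun y => X (vec3 y)) @` B : set (borel4 R)).
Proof.
move=> oD cX iX mB BD.
(* [h] inverts [X] on its image. Its values elsewhere are discarded by [c], which is 0 off the image
   and hence defined on the whole space. *)
pose h (z : 'rV[R]_4) : 'rV[R]_3 := xget 0 [set x | D x /\ X x = z].
have hX x : D x -> h (X x) = x.
  move=> Dx; have [] := @xgetPex _ 0 [set x' | D x' /\ X x' = X x] (ex_intro _ x (conj Dx erefl)).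
  by move=> Dh /(iX _ _ (mem_set Dh) (mem_set Dx)).
pose c i : borel4 R -> measurableTypeR R := (fun z : borel4 R => h z 0 i) \_ (X @` D).
have mXD : measurable (X @` D : set (borel4 R)) by exact: image_open_measurable.
have mc i : measurable_fun setT (c i).
  apply/(measurable_restrictT _ mXD); apply: (measurability _ (RGenOInfty.measurableE R)).
  move=> _ [_ [a ->] <-].
  have E : X @` (D `&` (fun x : 'rV[R]_3 => x 0 i) @^-1` `]a, +oo[) =
      X @` D `&` (fun z : 'rV[R]_4 => h z 0 i) @^-1` `]a, +oo[.
    apply/seteqP; split.
      by move=> _ [x [Dx xa] <-]; split; [exists x|rewrite /= hX].
    by move=> _ [[x Dx <-]]; rewrite /= hX// => xa; exists x.
  suff : measurable (X @` (D `&` (fun x : 'rV[R]_3 => x 0 i) @^-1` `]a, +oo[) :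
      set (borel4 R)). by rewrite E.
  apply: image_open_measurable => [|x [Dx _]]; last exact: cX.
  have oa : open (`]a, +oo[%classic : set R) by exact: interval_open.
  by apply: (open_setI_preimage oD oa) => x _; exact: coord_continuous.
have mg : measurable_fun setT (fun z => ((c 0 z, c 1 z), c 2 z) : R3 R).
  by apply: measurable_fun_pair => //; exact: measurable_fun_pair.
have -> : (fun y => X (vec3 y)) @` B =
    X @` D `&` (fun z => ((c 0 z, c 1 z), c 2 z) : R3 R) @^-1` B.
  have gX x : D x -> ((c 0 (X x), c 1 (X x)), c 2 (X x)) = unvec3 x.
    move=> Dx; have XDx : X x \in X @` D by apply/mem_set; exists x.
    by rewrite /c /patch XDx /unvec3 hX.
  apply/seteqP; split=> [_ [y By <-]|_ [[x Dx <-]]].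
    have Dy := BD _ By; split; first by exists (vec3 y).
    by rewrite /= gX// vec3K.
  by rewrite /= gX// => Bx; exists (unvec3 x) => //; rewrite unvec3K.
by apply: measurableI => //; rewrite -[_ @^-1` _]setTI; exact: mg.
Qed.

(** * Uniqueness of densities *)

(* Both inequalities are strict, so [J2] integrates over [B] to strictly less
   than [q J1], that is to less than [q s (F @` B)], unless [m B = 0]. *)
Lemma measure0_lt_density d d' (Y : measurableType d) (Z : measurableType d')
    (R : realType) (m : {measure set Y -> \bar R}) (s : {measure set Z -> \bar R})
    (F : Y -> Z) (B : set Y) (J1 J2 : Y -> R) (mu : Z -> R) (q k : R) :
  measurable B -> (m B < +oo)%E -> measurable (F @` B) ->
  measurable_fun B J1 -> measurable_fun B J2 -> measurable_fun (F @` B) mu ->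
  (forall y, B y -> [/\ `|J1 y| <= k, `|J2 y| <= k & `|mu (F y)| <= k]) ->
  s (F @` B) = (\int[m]_(y in B) (J1 y)%:E)%E ->
  (\int[s]_(z in F @` B) (mu z)%:E)%E = (\int[m]_(y in B) (J2 y)%:E)%E ->
  (forall y, B y -> q < mu (F y)) -> (forall y, B y -> J2 y < q * J1 y) ->
  m B = 0%E.
Proof.
move=> mB Bfin mFB mJ1 mJ2 mmu bd sFB intmu qmu Jq.
have bounded_int (f : Y -> R) : measurable_fun B f -> (forall y, B y -> `|f y| <= k) ->
    m.-integrable B (EFin \o f).
  move=> mf fk; apply: measurable_bounded_integrable => //.
  exists k; split; first exact: num_real.
  by move=> M kM y By /=; rewrite (le_trans (fk y By))// ltW.
have iJ1 : m.-integrable B (EFin \o J1) by apply: bounded_int => // y /bd[].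
have iJ2 : m.-integrable B (EFin \o J2) by apply: bounded_int => // y /bd[].
have sfin : (s (F @` B) < +oo)%E.
  by rewrite -ge0_fin_numE// sFB; exact: integrable_fin_num.
have imu : s.-integrable (F @` B) (EFin \o mu).
  apply: measurable_bounded_integrable => //.
  exists k; split; first exact: num_real.
  move=> M kM _ [y By <-] /=; have [_ _ muk] := bd y By.
  by rewrite (le_trans muk)// ltW.
have iq : s.-integrable (F @` B) (EFin \o cst q).
  apply: measurable_bounded_integrable => //.
  by exists `|q|; split; [exact: num_real|move=> M qM y _ /=; rewrite ltW].
have le1 : (q%:E * \int[m]_(y in B) (J1 y)%:E <= \int[m]_(y in B) (J2 y)%:E)%E.
  rewrite -sFB -intmu -integral_cst//; apply: le_integral => // z.
  by rewrite inE => -[y By <-]; rewrite lee_fin ltW// qmu.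
pose f y := q * J1 y - J2 y.
have mf : measurable_fun B f.
  by apply: measurable_funB => //; exact: measurable_funM.
have iqJ1 : m.-integrable B (EFin \o (fun y => q * J1 y)).
  exact: (integrableZl mB q iJ1).
(* [f] is positive on [B] with integral at most 0, so it vanishes almost everywhere on [B] although
   it vanishes nowhere there. *)
have intf : (\int[m]_(y in B) `|(f y)%:E| = 0)%E.
  have fE : (\int[m]_(y in B) `|(f y)%:E| =
      \int[m]_(y in B) ((q * J1 y)%:E - (J2 y)%:E))%E.
    apply: eq_integral => y; rewrite inE => By.
    by rewrite gee0_abs// lee_fin subr_ge0 ltW// Jq.
  apply/eqP; rewrite eq_le integral_ge0// andbT fE integralB_EFin//.
  rewrite sube_le0; apply: le_trans le1; rewrite le_eqVlt; apply/orP; left; apply/eqP.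
  exact: (integralZl mB iJ1 q).
have /(ae_eq_integral_abs m mB)[|N [mN N0 BN]] := intf; first exact/measurable_EFinP.
apply/negligibleP => //; exists N; split => // y By; apply: BN => /= /(_ By) /eqP.
by rewrite eqe subr_eq0 gt_eqF// Jq.
Qed.

Lemma negligible_bigcup_countType d (T : measurableType d) (R : realType)
    (mu : {measure set T -> \bar R}) (I : countType) (F : I -> set T) :
  (forall i, mu.-negligible (F i)) -> mu.-negligible (\bigcup_i F i).
Proof.
move=> F0; apply: (@negligibleS _ _ _ _
  (\bigcup_k (if unpickle k is Some i then F i else set0))); last first.
  by apply: negligible_bigcup => k; case: unpickle => // ; exact: negligible_set0.
by move=> x [i _ Fx]; exists (pickle i) => //; rewrite pickleK.
Qed.

(** Where the identity fails, a rational number strictly separates J2 / J1 from mu at the image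
    point. For each rational and each truncation the corresponding set is null by
    [measure0_lt_density], and there are countably many of them. *)
Lemma measure0_neq_density d d' (Y : measurableType d) (Z : measurableType d')
    (R : realType) (m : {measure set Y -> \bar R}) (s : {measure set Z -> \bar R})
    (F : Y -> Z) (D : set Y) (J1 J2 : Y -> R) (mu : Z -> R) :
  sigma_finite setT m -> measurable D ->
  (forall B, measurable B -> B `<=` D -> measurable (F @` B)) ->
  measurable_fun D J1 -> measurable_fun D J2 -> measurable_fun D (mu \o F) ->
  measurable_fun (F @` D) mu ->
  (forall y, D y -> 0 < J1 y) ->
  (forall B, measurable B -> B `<=` D ->
     s (F @` B) = (\int[m]_(y in B) (J1 y)%:E)%E /\
     (\int[s]_(z in F @` B) (mu z)%:E)%E = (\int[m]_(y in B) (J2 y)%:E)%E) ->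
  m.-negligible [set y | D y /\ mu (F y) * J1 y != J2 y].
Proof.
move=> [C CT mC] mD mF mJ1 mJ2 mmuF mmu J10 intF.
(* The first index selects a piece of finite measure, the second bounds the three functions;
   together they make all integrals finite. *)
pose B (t : nat * nat) : set Y := C t.1 `&` (D `&` J1 @^-1` `[- t.2%:R, t.2%:R])
  `&` (D `&` J2 @^-1` `[- t.2%:R, t.2%:R]) `&` (D `&` (mu \o F) @^-1` `[- t.2%:R, t.2%:R]).
have mB t : measurable (B t).
  apply: measurableI; [apply: measurableI; [apply: measurableI|]|].
  - by have [] := mC t.1.
  - exact: mJ1.
  - exact: mJ2.
  - exact: mmuF.
have BfinS t (A : set Y) : measurable A -> A `<=` B t -> (m A < +oo)%E.
  move=> mA AB; have [mCt Cfin] := mC t.1; apply: le_lt_trans Cfin.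
  by apply: le_measure; rewrite ?inE// => y /AB[[[]]].
pose N1 (u : nat * nat * rat) := B u.1 `&` (D `&` (mu \o F) @^-1` `]ratr u.2, +oo[)
   `&` (D `&` (fun y => ratr u.2 * J1 y - J2 y) @^-1` `]0, +oo[).
pose N2 (u : nat * nat * rat) := B u.1 `&` (D `&` (mu \o F) @^-1` `]-oo, ratr u.2[)
   `&` (D `&` (fun y => ratr u.2 * J1 y - J2 y) @^-1` `]-oo, 0[).
have mq (q : R) : measurable_fun D (fun y => q * J1 y - J2 y).
  by apply: measurable_funB => //; exact: measurable_funM.
have mN1 u : measurable (N1 u).
  by apply: measurableI; [apply: measurableI => //; exact: mmuF|exact: mq].
have mN2 u : measurable (N2 u).
  by apply: measurableI; [apply: measurableI => //; exact: mmuF|exact: mq].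
have bd t y : B t y -> [/\ D y, `|J1 y| <= t.2%:R, `|J2 y| <= t.2%:R & `|mu (F y)| <= t.2%:R].
  move=> [[[_ [Dy]]]]; rewrite /= !in_itv /= => h1 [_ h2] [_ h3].
  by rewrite !ler_norml.
have mfF A : measurable A -> A `<=` D -> measurable_fun (F @` A) mu.
  by move=> mA AD; apply: measurable_funS mmu; [exact: mF|exact: image_subset].
have N10 u : m (N1 u) = 0%E.
  have ND : N1 u `<=` D by move=> y [[/bd[]]].
  have [H1 H2] := intF _ (mN1 u) ND.
  apply: (measure0_lt_density (q := ratr u.2) (k := u.1.2%:R)
    _ _ _ _ _ _ _ H1 H2) => //.
  - by apply: (BfinS u.1) => // y [[]].
  - exact: mF.
  - exact: measurable_funS mJ1.
  - exact: measurable_funS mJ2.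
  - exact: mfF.
  - by move=> y [[/bd[_ h1 h2 h3] _] _].
  - by move=> y [[_ [_ +]] _]; rewrite /= in_itv /= andbT.
  - by move=> y [_ [_ +]]; rewrite /= in_itv /= andbT subr_gt0.
have N20 u : m (N2 u) = 0%E.
  have ND : N2 u `<=` D by move=> y [[/bd[]]].
  have [H1 H2] := intF _ (mN2 u) ND.
  have fin : (m (N2 u) < +oo)%E by apply: (BfinS u.1) => // y [[]].
  have bdN y : N2 u y -> [/\ `|J1 y| <= u.1.2%:R, `|J2 y| <= u.1.2%:R & `|mu (F y)| <= u.1.2%:R].
    by move=> [[/bd[]]].
  have bounded_int (f : Y -> R) : measurable_fun (N2 u) f ->
      (forall y, N2 u y -> `|f y| <= u.1.2%:R) -> m.-integrable (N2 u) (EFin \o f).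
    move=> mf fk; apply: measurable_bounded_integrable => //.
    exists u.1.2%:R; split; first exact: num_real.
    by move=> M kM y Ny /=; rewrite (le_trans (fk y Ny))// ltW.
  have iJ1 : m.-integrable (N2 u) (EFin \o J1).
    by apply: bounded_int => [|y /bdN[]//]; exact: measurable_funS mJ1.
  have iJ2 : m.-integrable (N2 u) (EFin \o J2).
    by apply: bounded_int => [|y /bdN[]//]; exact: measurable_funS mJ2.
  have imu : s.-integrable (F @` N2 u) (EFin \o mu).
    apply: measurable_bounded_integrable; [exact: mF| |exact: mfF|].
      by rewrite -ge0_fin_numE// H1; exact: integrable_fin_num.
    exists u.1.2%:R; split; first exact: num_real.
    move=> M kM _ [y /bdN[_ _ h] <-] /=; by rewrite (le_trans h)// ltW.
  (* The reversed inequalities are reduced to the first case by negating mu, J2 and q. *)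
  have H3 : (\int[s]_(z in F @` N2 u) (-1 * mu z)%:E =
      \int[m]_(y in N2 u) (-1 * J2 y)%:E)%E.
    apply: (etrans (integralZl (mF _ (mN2 u) ND) imu (-1))).
    apply: (etrans _ (esym (integralZl (mN2 u) iJ2 (-1)))).
    by congr (_ * _)%E.
  apply: (measure0_lt_density (q := - ratr u.2) (k := u.1.2%:R)
    _ _ _ _ _ _ _ H1 H3) => //.
  - exact: mF.
  - exact: measurable_funS mJ1.
  - by apply: measurable_funM => //; exact: measurable_funS mJ2.
  - by apply: measurable_funM => //; exact: mfF.
  - by move=> y /bdN[h1 h2 h3]; rewrite !mulN1r !normrN.
  - by move=> y [[_ [_ +]] _]; rewrite /= in_itv /= mulN1r ltrN2.
  - by move=> y [_ [_ +]]; rewrite /= in_itv /= mulN1r mulNr ltrN2 subr_lt0.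
apply: (@negligibleS _ _ _ _ (\bigcup_u (N1 u `|` N2 u))); last first.
  apply: negligible_bigcup_countType => u.
  apply: negligibleU; first by apply/negligibleP; [exact: mN1|exact: N10].
  by apply/negligibleP; [exact: mN2|exact: N20].
move=> y [Dy neq].
have J1y := J10 _ Dy.
have [k kE] : exists k : nat, [/\ `|J1 y| <= k%:R, `|J2 y| <= k%:R & `|mu (F y)| <= k%:R].
  pose M := Num.max `|J1 y| (Num.max `|J2 y| `|mu (F y)|).
  have MM : M <= (Num.bound M)%:R by rewrite ltW// archi_boundP// !le_max normr_ge0.
  exists (Num.bound M).
  by move: MM; rewrite /M; set b := (_%:R); rewrite !ge_max => /andP[-> /andP[-> ->]].
have [i _ Ci] : (\bigcup_i C i) y by rewrite -CT.
have By : B (i, k) y.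
  by rewrite /B /= !in_itv /= -!ler_norml; case: kE => -> -> ->.
have div : J2 y / J1 y * J1 y = J2 y by rewrite divfK// gt_eqF.
have [lt|gt|E] := ltgtP (J2 y / J1 y) (mu (F y)).
- have [q] := rat_in_itvoo lt; rewrite in_itv /= => /andP[q1 q2].
  exists ((i, k), q) => //; left; split; [split => //|]; split => //=.
    by rewrite in_itv /= q2.
  by rewrite in_itv /= andbT subr_gt0 -ltr_pdivrMr.
- have [q] := rat_in_itvoo gt; rewrite in_itv /= => /andP[q1 q2].
  exists ((i, k), q) => //; right; split; [split => //|]; split => //=.
  by rewrite in_itv /= subr_lt0 -ltr_pdivlMr.
- by move: neq; rewrite -E div eqxx.
Qed.

(** * The discrete surface *)

(** A monomial of degree at most one is 1 or a coordinate, and both respect affine combinations. *)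
Lemma polynomial_fun1_affine (R : realType) m (q : 'rV[R]_3 -> R)
    (node : 'I_m -> 'rV[R]_3) (l : 'I_m -> R) :
  polynomial_fun 1 q -> \sum_i l i = 1 ->
  q (\sum_i l i *: node i) = \sum_i l i * q (node i).
Proof.
move=> [c qE] l1; rewrite qE.
under [RHS]eq_bigr => i _ do rewrite qE mulr_sumr.
rewrite exchange_big /=; apply: eq_bigr => a /= a1.
under [RHS]eq_bigr => i _ do rewrite mulrCA.
rewrite -mulr_sumr; congr (_ * _).
have [a0|/existsP[j aj]] := boolP [forall j, a j == 0 :> nat].
  have mon1 (x : 'rV[R]_3) : \prod_i x 0 i ^+ a i = 1.
    by apply: big1 => i _; rewrite (eqP (forallP a0 i)) expr0.
  by rewrite mon1; under eq_bigr => i _ do rewrite mon1 mulr1.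
have {}aj : (a j : nat) = 1%N.
  by move: aj; case: (a j) => [[|[|]]].
have ai i : i != j -> (a i : nat) = 0%N.
  move=> ij; move: a1; rewrite (bigD1 j)//= aj (bigD1 i)//=.
  by case: (a i : nat).
have monE (x : 'rV[R]_3) : \prod_i x 0 i ^+ a i = x 0 j.
  rewrite (bigD1 j)//= aj expr1 big1 ?mulr1// => i /ai ->.
  by rewrite expr0.
rewrite monE summxE; apply: eq_bigr => i _; by rewrite mxE monE.
Qed.

Lemma slab_sub (R : realType) (T : R) N tk n : time_partition T N tk ->
  (1 <= n <= N)%N -> slab tk n `<=` `[0, T].
Proof.
move=> [t0 tN tinc] /andP[n1 nN].
have mono i j : (i <= j)%N -> (j <= N)%N -> tk i <= tk j.
  elim: j => [|j IH]; first by rewrite leqn0 => /eqP->.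
  rewrite leq_eqVlt => /orP[/eqP-> //|]; rewrite ltnS => ij jN.
  by rewrite (le_trans (IH ij (ltnW jN)))// ltW// tinc.
move=> t; rewrite /slab /= !in_itv /= => /andP[h1 h2]; apply/andP; split.
  by rewrite -t0 (le_trans _ h1)// mono// (leq_trans (leq_pred n)).
by rewrite -tN (le_trans h2)// mono.
Qed.

Lemma node_in_simplex (R : realType) m (node : 'I_m -> 'rV[R]_3)
    (K : {set 'I_m}) i : i \in K -> simplex node K (node i).
Proof.
move=> iK; exists (fun j => (j == i)%:R); split=> [j|j jK||].
- exact: ler0n.
- by case: eqP => // E; rewrite E iK in jK.
- by rewrite (bigD1 i)//= eqxx big1 ?addr0// => j /negPf->.
- rewrite (bigD1 i)//= eqxx scale1r big1 ?addr0// => j /negPf->.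
  by rewrite scale0r.
Qed.

(** [nodal_interpolant] speaks of each time separately. Expressing [phil] by nodal values of [phih]
    reveals its joint dependence on space and time. *)
Lemma nodal_interpolantE (R : realType) (Omega : set 'rV[R]_3) (T : R) m
    (node : 'I_m -> 'rV[R]_3) (mesh : {set {set 'I_m}})
    (phih phil : 'rV[R]_4 -> R) (K : {set 'I_m}) (l : 'I_m -> R) t :
  nodal_interpolant Omega T node mesh phih phil -> K \in mesh -> `[0, T]%classic t ->
  (forall i, 0 <= l i) -> (forall i, i \notin K -> l i = 0) -> \sum_i l i = 1 ->
  phil (st (\sum_i l i *: node i) t) =
  \sum_(i in K) l i * phih (st (node i) t).
Proof.
move=> /(_ t) + KM tT l0 lK l1 => /(_ tT)[[_ /(_ K KM)[q q1 qE]] phE].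
rewrite qE; last by exists l.
rewrite (polynomial_fun1_affine node q1 l1) (bigID (mem K)) /= [X in _ + X]big1 ?addr0.
  apply: eq_bigr => i iK; rewrite -(phE K)// qE//.
  exact: node_in_simplex.
by move=> i /lK ->; rewrite mul0r.
Qed.

Lemma sp_sum (R : realType) (I : finType) (F : I -> 'rV[R]_4) :
  sp (\sum_i F i) = \sum_i sp (F i).
Proof. by apply: (big_morph _ (@spD R)); exact: raddf0. Qed.

Lemma tm_sum (R : realType) (I : finType) (F : I -> 'rV[R]_4) :
  tm (\sum_i F i) = \sum_i tm (F i).
Proof. by apply: (big_morph _ (@tmD R)); rewrite /tm mxE. Qed.

Lemma continuous_mulmxr (R : realType) m n (M : 'M[R]_(m, n)) :
  continuous (fun v : 'rV[R]_m => v *m M).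
Proof.
move=> v; apply: differentiable_continuous; apply: differentiable_rV => j.
have -> : (fun y : 'rV[R]_m => (y *m M) 0 j) =
    \sum_(i < m) (fun y : 'rV[R]_m => y 0 i *: M i j).
  by apply/funext => y; rewrite fct_sumE mxE.
apply: differentiable_sum => i; apply: differentiableZl.
exact: differentiable_coord.
Qed.

(** The set is a linear image of a compact set of barycentric coordinates and times. In these
    variables the level function is linear in the coordinates and polynomial in t, so its zero set
    is closed; neither joint continuity of [phil] nor an inverse of the barycentric map has to be
    established. *)
Lemma compact_Slin_prism (R : realType) (Omega : set 'rV[R]_3) (T : R) m
    (node : 'I_m -> 'rV[R]_3) (mesh : {set {set 'I_m}}) (creg : R) (N : nat)
    (tk : nat -> R) (kgs kgq : nat) (phih phil : 'rV[R]_4 -> R) n K :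
  triangulation Omega node mesh creg -> time_partition T N tk ->
  st_fe_space Omega node mesh N tk kgs kgq phih ->
  nodal_interpolant Omega T node mesh phih phil ->
  (1 <= n <= N)%N -> K \in mesh ->
  compact (cylinder (simplex node K) (slab tk n) `&` [set z | phil z = 0]).
Proof.
move=> tri tp fe nod nN KM; have [u [_ uE]] := fe n nN.
have phihE i t : i \in K -> slab tk n t ->
    phih (st (node i) t) = \sum_(k < kgq.+1) t ^+ k * u k (node i).
  move=> iK; apply: uE; rewrite (mesh_cover tri); exists K => //.
  exact: node_in_simplex.
pose M : 'M[R]_(m + 1, 4) := col_mx (\matrix_i st (node i) 0) (st 0 1).
pose l (v : 'rV[R]_(m + 1)) i := v 0 (lshift 1 i).
pose tt (v : 'rV[R]_(m + 1)) := v 0 (rshift m 0).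
have vM v : v *m M = st (\sum_i l v i *: node i) (tt v).
  rewrite /M -{1}[v]hsubmxK mul_row_col.
  rewrite !mulmx_sum_row big_ord_recl big_ord0 addr0.
  rewrite mxE -/(tt v) row_id; apply: st_eq.
    rewrite spD spZ !spst scaler0 addr0.
    rewrite sp_sum; apply: eq_bigr => i _.
    by rewrite spZ rowK spst mxE.
  rewrite tmD tmZ !tmst mulr1 tm_sum big1 ?add0r// => i _.
  by rewrite tmZ rowK tmst mulr0.
pose f (v : 'rV[R]_(m + 1)) : R :=
  \sum_(i in K) l v i * \sum_(k < kgq.+1) tt v ^+ k * u k (node i).
pose L : set 'rV[R]_(m + 1) := [set v | [/\ forall i, 0 <= l v i,
  forall i, i \notin K -> l v i = 0, \sum_i l v i = 1, slab tk n (tt v) & f v = 0]].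
have cl i : continuous (fun v => l v i) by exact: coord_continuous.
have ct : continuous tt by exact: coord_continuous.
have csum (I : finType) (P : pred I) (g : I -> 'rV[R]_(m + 1) -> R) :
    (forall i, continuous (g i)) -> continuous (fun v => \sum_(i | P i) g i v).
  by move=> cg; apply: continuous_big => //; exact: add_continuous.
have cf : continuous f.
  apply: (csum) => i v; apply: (@continuousM _ _ (fun v => l v i)); first exact: cl.
  move: v; apply: (csum) => k v; apply: (@continuousM _ _ (fun v => tt v ^+ k)).
    exact: (continuous_comp (ct v) (@exprn_continuous R k (tt v))).
  exact: cst_continuous.
have closedP (g : 'rV[R]_(m + 1) -> R) (A : set R) :
    continuous g -> closed A -> closed (g @^-1` A).
  by move=> cg cA; apply: preimage_closed => // x _; exact: cg.
have cL : closed L.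
  rewrite (_ : L = \bigcap_i [set v | 0 <= l v i] `&`
    \bigcap_(i in [set i | i \notin K]) [set v | l v i = 0] `&`
    [set v | \sum_i l v i = 1] `&` (tt @^-1` slab tk n) `&` (f @^-1` [set 0])).
    apply: closedI; last by apply: closedP => //; exact: closed_eq.
    apply: closedI; last by apply: closedP => //; exact: interval_closed.
    apply: closedI; last first.
      apply: (closedP (fun v => \sum_i l v i) [set x | x = 1]); last exact: closed_eq.
      exact: csum.
    apply: closedI; apply: closed_bigI => i _.
      by apply: (closedP (l^~ i) [set x | 0 <= x]); [exact: cl|exact: closed_ge].
    by apply: (closedP (l^~ i) [set x | x = 0]); [exact: cl|exact: closed_eq].
  apply/seteqP; split=> v.
    move=> [h1 h2 h3 h4 h5]; split => //; split => //; split => //.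
    by split => [i _|i iK]; [exact: h1|exact: h2].
  move=> [[[[h1 h2] h3] h4] h5]; split=> // i; exact: h1.
have bL : bounded_set L.
  exists (1 + `|tk n.-1| + `|tk n|); split; first exact: num_real.
  move=> B hB v [l0 _ l1]; rewrite /slab /= in_itv /= => /andP[t1 t2] _.
  apply: ltW; apply/rV_norm_ltP; first by rewrite (le_lt_trans _ hB)// !addr_ge0.
  move=> j; apply: le_lt_trans hB.
  have := ler_norm (tk n); have := ler_norm (- tk n.-1); rewrite normrN => h1 h2.
  have n0 := normr_ge0 (tk n); have n1 := normr_ge0 (tk n.-1).
  case: (split_ordP j) => i ->.
    rewrite -/(l v i) ger0_norm//.
    have : l v i <= 1 by rewrite -l1 (bigD1 i)//= lerDl sumr_ge0.
    lra.
  rewrite (_ : i = 0) ?ord1// -/(tt v) ler_norml; apply/andP; split; lra.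
have KL : compact L by apply: bounded_closed_compact.
rewrite (_ : _ `&` _ = (fun v => v *m M) @` L).
  apply: continuous_compact => //.
  by apply: continuous_subspaceT; exact: continuous_mulmxr.
have philE v : (forall i, 0 <= l v i) -> (forall i, i \notin K -> l v i = 0) ->
    \sum_i l v i = 1 -> slab tk n (tt v) -> phil (v *m M) = f v.
  move=> l0 lK l1 ts; rewrite vM (nodal_interpolantE nod KM (slab_sub tp nN ts) l0 lK l1).
  by apply: eq_bigr => i iK; rewrite phihE.
apply/seteqP; split=> [z [[[l' [l0 lK l1 zl]] zt] phi0]|_ [v [l0 lK l1 ts f0] <-]].
  pose v : 'rV[R]_(m + 1) := row_mx (\row_i l' i) (tm z)%:M.
  have lv i : l v i = l' i by rewrite /l row_mxEl mxE.
  have tv : tt v = tm z by rewrite /tt row_mxEr mxE eqxx mulr1n.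
  have lvE : (fun i => l v i) = l' by apply/funext.
  have vz : v *m M = z.
    by rewrite vM tv (eq_bigr (fun i => l' i *: node i)) => [|i _]; rewrite -?zl ?stK ?lv.
  exists v => //; split; rewrite ?tv//.
  - by move=> i; rewrite lv.
  - by move=> i /lK; rewrite lv.
  - by under eq_bigr => i _ do rewrite lv.
  - rewrite -philE ?tv ?vz//; first by move=> i; rewrite lv.
      by move=> i /lK; rewrite lv.
    by under eq_bigr => i _ do rewrite lv.
split; last by rewrite /= philE.
split; last by rewrite /= vM tmst.
by exists (l v); split => //; rewrite vM spst.
Qed.

(* [g (X (x + r e))] is the point of [C] above [X (x + r e)]; since ['J theta y]
   is invertible its increment is [r ('d X x e) ('J theta y)^-1 + o(r)], and [q]
   does not change along it. *)
Lemma tangent_orthogonal (R : realType) n (A C : set 'rV[R]_4)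
    (Theta theta : 'rV[R]_4 -> 'rV[R]_4) (q : 'rV[R]_4 -> R)
    (X : 'rV[R]_n -> 'rV[R]_4) (x e : 'rV[R]_n) (y : 'rV[R]_4) :
  homeomorphism_onto_image A Theta -> C `<=` A -> C y -> Theta y = X x ->
  differentiable X x -> differentiable theta y -> differentiable q y ->
  (forall y', C y' -> theta y' = Theta y') -> (forall y', C y' -> q y' = 0) ->
  'J theta y \in unitmx ->
  (forall eps : R, 0 < eps -> exists r : R, [/\ r != 0, `|r| < eps &
     exists2 y', C y' & Theta y' = X (x + r *: e)]) ->
  dot (grad q y *m (invmx ('J theta y))^T) ('d X x e) = 0.
Proof.
move=> [_ [g cg gK]] CA Cy yx dX dth dq thE qE Ju acc.
set J := 'J theta y in Ju *; set w := 'd X x e; set u := w *m invmx J.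
have -> : dot (grad q y *m (invmx J)^T) w = 'd q y u.
  by rewrite diff_grad// [RHS]dotC /u !dotE trmx_mul mulmxA.
have [k k0 kP] : exists2 k : R, 0 < k & forall v : 'rV[R]_4, `|v *m invmx J| <= k * `|v|.
  apply: (@linear_lipschitz R _ _ (mulmxr (invmx J))); exact: continuous_mulmxr.
have [l l0 lP] := linear_lipschitz (diff_continuous dq).
(* M will bound |h| / |r| for the increment h above the prism, and Q the total error divided by eta
   |r|. *)
pose M := 2 * `|u| + `|e|; have M0 : 0 <= M by rewrite addr_ge0// mulr_ge0.
pose Q := M + l * k * (`|e| + M).
have Q0 : 0 <= Q by rewrite addr_ge0// !mulr_ge0 ?addr_ge0// ltW.
apply/eqP; rewrite -normr_le0; apply/ler_addgt0Pr => eps eps0; rewrite add0r.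
(* The first bound allows a term in |h| to be absorbed into the left side, the second brings the
   final error below eps. *)
pose eta := Num.min (1 / (2 * k)) (eps / (Q + 1)).
have eta0 : 0 < eta by rewrite lt_min !divr_gt0 ?mulr_gt0// ltr_wpDl.
have etak : k * eta <= 1 / 2.
  have : eta <= 1 / (2 * k) by rewrite ge_min lexx.
  by rewrite ler_pdivlMr ?mulr_gt0// => h; lra.
have etaQ : eta * Q <= eps.
  have : eta <= eps / (Q + 1) by rewrite ge_min lexx orbT.
  rewrite ler_pdivlMr; last by rewrite ltr_wpDl.
  by apply: le_trans; rewrite ler_pM2l// lerDl.
have /nbhs_ballP[d1 /= d10 near1] := diff_near dth eta0.
have /nbhs_ballP[d2 /= d20 near2] := diff_near dq eta0.
have /nbhs_ballP[d3 /= d30 near3] := diff_near dX eta0.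
have Xx : (Theta @` A) (X x) by exists y => //; exact: CA.
have gXx : g (X x) = y by rewrite -yx gK//; exact: CA.
have cgx := (subspace_continuousP _ _).1 cg _ Xx.
have d12 : 0 < Num.min d1 d2 by rewrite lt_min d10.
(* Continuity of the inverse forces y' close to y; only then do the expansions of [theta] and [q] at
   y apply. *)
have gnear : \forall h \near (0 : 'rV[R]_n), (Theta @` A) (X (x + h)) ->
    ball y (Num.min d1 d2) (g (X (x + h))).
  have := cgx _ (nbhsx_ballx (g (X x)) _ d12); rewrite gXx /= => B.
  have cX := differentiable_continuous dX.
  exact: ((nbhs0P _ x).1 (cX _ B)).
have /nbhs_ballP[d4 /= d40 near4] := gnear.
have e1 : 0 < `|e| + 1 by rewrite ltr_wpDl.
have m34 : 0 < Num.min d3 d4 / (`|e| + 1) by rewrite divr_gt0// lt_min d30.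
have [r [r0 rsmall [y' Cy' y'X]]] := acc _ m34.
have re : `|r *: e| < Num.min d3 d4.
  rewrite normrZ; rewrite ltr_pdivlMr// in rsmall.
  by rewrite (le_lt_trans _ rsmall)// ler_wpM2l// lerDl.
move: re; rewrite lt_min => /andP[re3 re4].
have ballN (V : normedModType R) (d : R) (v : V) : `|v| < d -> ball 0 d v.
  by rewrite -ball_normE /= sub0r normrN.
have gy' : g (X (x + r *: e)) = y' by rewrite -y'X gK//; exact: CA.
have : ball y (Num.min d1 d2) y'.
  rewrite -gy'; apply: (near4 _ (ballN _ _ _ re4)).
  by rewrite -y'X; exists y' => //; exact: CA.
rewrite -ball_normE /= distrC lt_min => /andP[h1 h2].
set h := y' - y in h1 h2.
have y'E : y + h = y' by rewrite addrC subrK.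
have := near1 _ (ballN _ _ _ h1); have := near2 _ (ballN _ _ _ h2).
have := near3 _ (ballN _ _ _ re3).
rewrite y'E !thE// !qE// yx y'X subrr sub0r normrN linearZ /= -/w.
rewrite -(mul_rV_jacobian theta) -/J.
set rho := X (x + r *: e) - X x => b3 b2 b1.
(* Both h J and r w equal rho up to their linearisation errors; this solves for h. *)
have hE : h = r *: u + ((rho - r *: w) - (rho - h *m J)) *m invmx J.
  have -> : rho - r *: w - (rho - h *m J) = h *m J - r *: w.
    by rewrite opprB addrC subrKA.
  by rewrite mulmxBl mulmxK// -scalemxAl -/u addrC subrK.
have b0 : `|(rho - r *: w) - (rho - h *m J)| <= eta * `|r| * `|e| + eta * `|h|.
  by rewrite (le_trans (ler_normB _ _))// lerD// (le_trans b3)// normrZ mulrA.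
set v := _ - (rho - _) in hE b0.
have vb : `|v *m invmx J| <= k * (eta * `|r| * `|e| + eta * `|h|).
  by rewrite (le_trans (kP v))// ler_pM2l.
have hM : `|h| <= `|r| * M.
  have : `|h| <= `|r| * `|u| + k * (eta * `|r| * `|e| + eta * `|h|).
    by rewrite {1}hE (le_trans (ler_normD _ _))// lerD// normrZ.
  have re0 : 0 <= `|r| * `|e| by rewrite mulr_ge0.
  have ke0 : 0 <= k * eta by rewrite mulr_ge0// ltW.
  have E1 := ler_wpM2r re0 etak; have E2 := ler_wpM2r (normr_ge0 h) etak.
  have -> : k * (eta * `|r| * `|e| + eta * `|h|) =
    k * eta * (`|r| * `|e|) + k * eta * `|h| by ring.
  have -> : `|r| * M = 2 * (`|r| * `|u|) + `|r| * `|e| by rewrite /M; ring.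
  move: (k * eta * _) (k * eta * _) E1 E2 => E3 E4 E1 E2; lra.
have rpos : 0 < `|r| by rewrite normr_gt0.
rewrite -(ler_pM2l rpos) -normrM.
have -> : r * 'd q y u = 'd q y h - 'd q y (v *m invmx J).
  by rewrite {1}hE linearD addrK linearZ.
rewrite (le_trans (ler_normB _ _))//.
have c1 : `|'d q y (v *m invmx J)| <= l * (k * (eta * `|r| * `|e| + eta * `|h|)).
  by rewrite (le_trans (lP _))// ler_pM2l.
have c2 : eta * `|h| <= eta * (`|r| * M) by rewrite ler_pM2l.
have c3 : l * (k * (eta * `|r| * `|e| + eta * `|h|)) <=
    l * (k * (eta * `|r| * `|e| + eta * (`|r| * M))) by rewrite !ler_pM2l// lerD2l.
have c4 : eta * (`|r| * M) + l * (k * (eta * `|r| * `|e| + eta * (`|r| * M))) =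
    `|r| * (eta * Q) by rewrite /Q; ring.
have c5 : `|r| * (eta * Q) <= `|r| * eps by rewrite ler_pM2l.
apply: (le_trans (lerD (le_trans b2 c2) (le_trans c1 c3))); by rewrite c4.
Qed.

(** * Patches of class C^1 *)

Lemma leb3_sigma_finite (R : realType) : sigma_finite setT (leb3 R).
Proof.
exists (fun k => (cube k `*` cube k) `*` cube k).
  apply/seteqP; split => // -[[x y] z] _.
  have [[]] : (setT x /\ setT y) /\ setT z by [].
  rewrite -bigcup_cube => -[i _ ix] [j _ jy] [k _ kz].
  exists (maxn (maxn i j) k) => //; split; [split|] => /=.
  - by apply: cubeS ix; rewrite (leq_trans (leq_maxl i j))// leq_maxl.
  - by apply: cubeS jy; rewrite (leq_trans (leq_maxr i j))// leq_maxl.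
  - by apply: cubeS kz; rewrite leq_maxr.
move=> k; have mk := @measurable_cube R k.
have cfin : lebesgue_measure (@cube R k) \is a fin_num.
  by rewrite ge0_fin_numE//; exact: lebesgue_measure_cube.
split; first by apply: measurableX => //; exact: measurableX.
have E2 : leb2 R (cube k `*` cube k) =
    (lebesgue_measure (@cube R k) * lebesgue_measure (@cube R k))%E.
  exact: product_measure1E.
have -> : leb3 R ((cube k `*` cube k) `*` cube k) =
    (leb2 R (cube k `*` cube k) * lebesgue_measure (@cube R k))%E.
  by apply: product_measure1E => //; exact: measurableX.
apply: lte_mul_pinfty; rewrite ?E2.
- exact: mule_ge0.
- exact: fin_numM.
- exact: lebesgue_measure_cube.
Qed.

(* A point isolated in [E] along axis [j] lies, for some [k], in the set [G j k]
   of points from which no offset [dist k t] leads back to [E]. *)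
Lemma negligible_isolated (R : realType) (E : set (R3 R)) : measurable E ->
  (leb3 R : {measure set (R3 R) -> \bar R}).-negligible [set y | E y /\
    exists j : 'I_3, ~ (forall eps : R, 0 < eps ->
      exists r : R, [/\ r != 0, `|r| < eps & E (shift3 j r y)])].
Proof.
move=> mE; set m : {measure set (R3 R) -> \bar R} := leb3 R.
pose dist (k : nat) (t : nat * nat) : R :=
  k.+1%:R^-1 / t.1.+1%:R - k.+1%:R^-1 / t.2.+1%:R.
pose G (j : 'I_3) (k : nat) := E `&`
  \bigcap_(t in [set t : nat * nat | (t.1 < t.2)%N]) (shift3 j (dist k t) @^-1` (~` E)).
have mG j k : measurable (G j k).
  apply: measurableI => //; rewrite bigcap_mkcond.
  rewrite -[X in measurable X]setCK setC_bigcap; apply: measurableC.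
  apply: countable_bigcupT_measurable => [|t]; first exact: countableP.
  case: ifPn => _; rewrite ?setCT//; apply: measurableC.
  by rewrite -[_ @^-1` _]setTI; apply: measurable_shift3 => //; exact: measurableC.
have G0 j k : m (G j k) = 0%E.
  apply: (@leb3_disjoint_shifts R k.+1%:R^-1 j) => //.
  move=> y a b [Ey Gy] ab [Es _]; exact: (Gy (a, b) ab Es).
apply: (@negligibleS _ _ _ _ (\bigcup_k (G 0 k `|` G 1 k `|` G 2 k))); last first.
  apply: negligible_bigcup => k; apply: negligibleU; first apply: negligibleU.
  - by apply/negligibleP; [exact: mG|exact: G0].
  - by apply/negligibleP; [exact: mG|exact: G0].
  - by apply/negligibleP; [exact: mG|exact: G0].
move=> y [Ey [j nacc]].
suff [k Gk] : exists k, G j k y.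
  exists k => //; move: Gk.
  have [->|[->|->]] : j = 0 \/ j = 1 \/ j = 2.
    case: j {nacc} => [[|[|[|]]]]// hj; [left|right;left|right;right]; exact: val_inj.
  - by left; left.
  - by left; right.
  - by right.
(* If y lies in no [G j k], every scale 1/(k+1) admits a nonzero offset of at most that size leading
   back to [E], so y is not isolated along axis j. *)
apply: contrapT => nG; apply: nacc => eps eps0.
have i0 : 0 <= eps^-1 by rewrite invr_ge0 ltW.
have := archi_boundP i0; set k := Num.bound _ => hk.
have ke : k.+1%:R^-1 < eps.
  rewrite -[ltRHS]invrK ltf_pV2 ?posrE ?invr_gt0//.
  by rewrite (lt_le_trans hk)// ler_nat.
apply: contrapT => nr; apply: nG; exists k; split => // -[a b] /= ab Es.
have k0 : 0 < k.+1%:R^-1 :> R by rewrite invr_gt0.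
have abR : b.+1%:R^-1 < a.+1%:R^-1 :> R by rewrite ltf_pV2 ?posrE// ltr_nat.
have b0 : 0 < b.+1%:R^-1 :> R by rewrite invr_gt0.
have a1 : a.+1%:R^-1 <= 1 :> R by rewrite invf_le1 ?ler1n.
apply: nr; exists (dist k (a, b)); split => //.
  by rewrite /dist /= -mulrBr mulf_neq0 ?gt_eqF// subr_gt0.
rewrite /dist /= -mulrBr normrM gtr0_norm// gtr0_norm ?subr_gt0//.
apply: le_lt_trans ke; rewrite ler_piMr// ?(ltW k0)//.
by rewrite lerBlDr (le_trans a1)// lerDl ltW.
Qed.

Lemma cvg_det (R : realType) (T : Type) (F : set_system T) (FF : Filter F) n
    (A : T -> 'M[R]_n) (B : 'M[R]_n) :
  (forall i j, A x i j @[x --> F] --> B i j) -> \det (A x) @[x --> F] --> \det B.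
Proof.
move=> cA; apply: cvg_big => [|s _]; first exact: add_continuous.
apply: cvgM; first exact: cvg_cst.
by apply: cvg_big => [|i _]; [exact: mul_continuous|exact: cA].
Qed.

Lemma cvg_det_gram (R : realType) (T : Type) (F : set_system T) (FF : Filter F)
    m n (A : T -> 'M[R]_(m, n)) (B : 'M[R]_(m, n)) :
  (forall i j, A x i j @[x --> F] --> B i j) ->
  \det (A x *m (A x)^T) @[x --> F] --> \det (B *m B^T).
Proof.
move=> cA; apply: cvg_det => i j.
have GE (M : 'M[R]_(m, n)) : (M *m M^T) i j = \sum_k M i k * M j k.
  by rewrite mxE; apply: eq_bigr => k _; rewrite [X in _ * X]mxE.
rewrite GE (_ : (fun y => _) = fun y => \sum_k A y i k * A y j k); last first.
  by apply/funext => y; rewrite GE.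
apply: cvg_big => [|k _]; first exact: add_continuous.
exact: cvgM (cA i k) (cA j k).
Qed.

Lemma gram_continuous (R : realType) (D : set 'rV[R]_3) (X : 'rV[R]_3 -> 'rV[R]_4) x :
  open D -> Ck 1 D X -> D x -> {for x, continuous (gram X)}.
Proof.
move=> oD [dX cX] Dx.
have JE : \forall y \near x, forall i j,
    'J X y i j = ('D_(delta_mx 0 i) X y) 0 j.
  apply: filterS (open_nbhs_nbhs (conj oD Dx)) => y Dy i j.
  by rewrite mxE deriveE//; exact: dX.
have cJ i j : 'J X y i j @[y --> x] --> 'J X x i j.
  pose k (y : 'rV[R]_3) := ('D_(delta_mx 0 i) X y) 0 j.
  have ck : k y @[y --> x] --> k x.
    exact: (cvg_comp _ _ (cX (delta_mx 0 i) x Dx) (@coord_continuous _ _ _ 0 j _)).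
  have kJ : \forall y \near x, k y = 'J X y i j.
    by apply: filterS JE => y JEy; exact: esym (JEy i j).
  rewrite (nbhs_singleton kJ) in ck.
  exact: (cvg_trans (@near_eq_cvg _ _ (nbhs x) _ k (fun y => 'J X y i j) kJ) ck).
have cG := @cvg_det_gram R _ (nbhs x) _ 3 4 (fun y => 'J X y) _ cJ.
have cs := @sqrt_continuous R (\det ('J X x *m ('J X x)^T)).
exact: (cvg_comp _ _ (cG _) cs).
Qed.

(** [Ck] gives continuity of ['D_v g] only for a fixed direction, so the moving direction ['D_v f y]
    is expanded in the standard basis. *)
Lemma Ck1_comp (R : realType) m n p (D : set 'rV[R]_m) (D' : set 'rV[R]_n)
    (f : 'rV[R]_m -> 'rV[R]_n) (g : 'rV[R]_n -> 'rV[R]_p) :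
  open D -> Ck 1 D f -> Ck 1 D' g -> f @` D `<=` D' -> Ck 1 D (g \o f).
Proof.
move=> oD [df cf] [dg cg] fD.
have fD' x : D x -> D' (f x) by move=> Dx; apply: fD; exists x.
split=> [x Dx|v x Dx]; first by apply: differentiable_comp; [exact: df|exact/dg/fD'].
pose h (y : 'rV[R]_m) := \sum_(i < n) ('D_v f y) 0 i *: 'D_(delta_mx 0 i) g (f y).
have hE y : D y -> 'D_v (g \o f) y = h y.
  move=> Dy; have dgy := dg _ (fD' _ Dy); have dfy := df _ Dy.
  rewrite deriveE; last exact: differentiable_comp.
  rewrite (congr1 (fun k => k v) (diff_comp dfy dgy)) /=.
  rewrite {1}[ 'd f y v]row_sum_delta linear_sum /h; apply: eq_bigr => i _.
  by rewrite linearZ /= !deriveE.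
have ch : {for x, continuous h}.
  apply: cvg_big => [||i _]; [exact: add_continuous|exact: nbhs_filter|].
  have c1 : ('D_v f y) 0 i @[y --> x] --> ('D_v f x) 0 i.
    exact: (cvg_comp _ _ (cf v x Dx) (@coord_continuous _ _ _ 0 i _)).
  have c2 : 'D_(delta_mx 0 i) g (f y) @[y --> x] --> 'D_(delta_mx 0 i) g (f x).
    exact: (cvg_comp _ _ (differentiable_continuous (df _ Dx))
      (cg (delta_mx 0 i) _ (fD' _ Dx))).
  exact: cvgZ c1 c2.
have hg : \forall y \near x, h y = 'D_v (g \o f) y.
  by apply: filterS (open_nbhs_nbhs (conj oD Dx)) => y Dy; rewrite hE.
have {}ch : h y @[y --> x] --> 'D_v (g \o f) x by rewrite hE.
exact: (cvg_trans (@near_eq_cvg _ _ (nbhs x) _ h ('D_v (g \o f)) hg) ch).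
Qed.

Lemma continuous_eq_open (T : topologicalType) (V : topologicalType) (D : set T)
    (f h : T -> V) x :
  open D -> D x -> (forall y, D y -> f y = h y) -> {for x, continuous h} ->
  {for x, continuous f}.
Proof.
move=> oD Dx fh ch; have hf : \forall y \near x, h y = f y.
  by apply: filterS (open_nbhs_nbhs (conj oD Dx)) => y Dy; rewrite fh.
have {}ch : h y @[y --> x] --> f x by rewrite fh.
exact: (cvg_trans (near_eq_cvg hf) ch).
Qed.

Lemma Ck1_closest (R : realType) (D : set 'rV[R]_4) (delta : 'rV[R]_4 -> R) :
  open D -> Ck 2 D delta -> Ck 1 D (closest delta).
Proof.
move=> oD C2; have [dd d2] := C2.
have dn z : D z -> differentiable (nrm delta) z := differentiable_nrm C2.
have dn0 z : D z -> differentiable (nrm0 delta) z.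
  by move=> Dz; apply: differentiable_nrm0; exact: dn.
split=> [z Dz|v z Dz]; first by apply: differentiable_closest; [exact: dd|exact: dn0].
(* [K y] is the derivative of [nrm0 delta] along v, in a form whose continuity is part of [Ck 2]. *)
pose K (y : 'rV[R]_4) : 'rV[R]_4 := \sum_(i < 3)
  'D_v ('D_(delta_mx 0 (lshift 1 i)) delta) y *: st (delta_mx 0 i) 0.
pose h (y : 'rV[R]_4) : 'rV[R]_4 :=
  v - ('D_v delta y *: nrm0 delta y + delta y *: K y).
apply: (continuous_eq_open (h := h) oD Dz).
  move=> y Dy; have dc := differentiable_closest (dd _ Dy) (dn0 _ Dy).
  rewrite deriveE// (diff_closest _ (dd _ Dy) (dn0 _ Dy)) /h (deriveE _ (dd _ Dy)).
  congr (_ - (_ + _ *: _)); rewrite (diff_nrm0 _ (dn _ Dy)) /K.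
  apply: st_eq; rewrite ?spst ?tmst.
    rewrite [LHS]row_sum_delta sp_sum; apply: eq_bigr => i _.
    rewrite spZ spst; congr (_ *: _); rewrite (diff_rV _ _ (dn _ Dy)).
    have -> : (fun x => nrm delta x 0 i) = 'D_(delta_mx 0 (lshift 1 i)) delta.
      by apply/funext => x; rewrite /nrm /sgrad /sp !mxE.
    by rewrite deriveE//; exact: differentiable_derive C2 Dy.
  by rewrite tm_sum big1// => i _; rewrite tmZ tmst mulr0.
have cK : {for z, continuous K}.
  apply: cvg_big => [||i _]; [exact: add_continuous|exact: nbhs_filter|].
  have c := (d2 (delta_mx 0 (lshift 1 i))).2 v z Dz.
  exact: cvgZ c (cvg_cst _).
have c1 : 'D_v delta y @[y --> z] --> 'D_v delta z.
  exact: differentiable_continuous (differentiable_derive v C2 Dz).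
have c2 : nrm0 delta y @[y --> z] --> nrm0 delta z.
  exact: differentiable_continuous (dn0 _ Dz).
have c3 : delta y @[y --> z] --> delta z.
  exact: differentiable_continuous (dd _ Dz).
exact: (cvgB (cvg_cst v) (cvgD (cvgZ c1 c2) (cvgZ c3 cK))).
Qed.

(** * Compact pieces and null sets of the discrete surface *)

(** Leaving out the open set [Omega] keeps this set compact for mesh elements K; on cut prisms
    membership in [Omega] follows from their inclusion in [U]. *)
Definition zero_prism (R : realType) m (node : 'I_m -> 'rV[R]_3) (tk : nat -> R)
    (phil : 'rV[R]_4 -> R) n (K : {set 'I_m}) : set 'rV[R]_4 :=
  cylinder (simplex node K) (slab tk n) `&` [set z | phil z = 0].

Lemma Slin_QS (R : realType) (Omega : set 'rV[R]_3) (T : R)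
    (phi : 'rV[R]_4 -> R) (U : set 'rV[R]_4) m (node : 'I_m -> 'rV[R]_3)
    (mesh : {set {set 'I_m}}) (tk : nat -> R) (phil : 'rV[R]_4 -> R) n :
  surface_neighborhood Omega T phi U -> QS node mesh tk phil n `<=` U ->
  Slin Omega tk phil n `&` QS node mesh tk phil n =
  \bigcup_(K in [set K | cut_element node mesh tk phil n K])
    zero_prism node tk phil n K.
Proof.
move=> hU QU; apply/seteqP; split=> [z [[_ phi0] [K cK pK]]|z [K cK [pK phi0]]].
  by exists K.
have Qz : QS node mesh tk phil n z by exists K.
have [Omz _] := U_sub_cylinder hU (QU _ Qz).
by split=> //; split => //; split => //; case: pK.
Qed.

Lemma compact_Theta_zero_prism (R : realType) (Omega : set 'rV[R]_3) (T : R)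
    (U : set 'rV[R]_4) m (node : 'I_m -> 'rV[R]_3)
    (mesh : {set {set 'I_m}}) (creg : R) (N : nat) (tk : nat -> R)
    (kgs kgq : nat) (phih phil : 'rV[R]_4 -> R)
    (Theta : nat -> 'rV[R]_4 -> 'rV[R]_4) n K :
  discrete_surface Omega T U node mesh creg N tk kgs kgq phih phil Theta ->
  (1 <= n <= N)%N -> cut_element node mesh tk phil n K ->
  compact (Theta n @` zero_prism node tk phil n K).
Proof.
move=> hd hn cK; have [_ _ [cT _]] := ds_Theta hd hn.
apply: continuous_compact; last first.
  apply: (compact_Slin_prism (ds_mesh hd) (ds_time hd) (ds_phih hd) (ds_phil hd) hn).
  by case: cK.
apply: continuous_subspaceW cT => z [pz _]; by exists K.
Qed.

Lemma measurable_Sh_slab (R : realType) (Omega : set 'rV[R]_3) (T : R)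
    (phi : 'rV[R]_4 -> R) (U : set 'rV[R]_4) m (node : 'I_m -> 'rV[R]_3)
    (mesh : {set {set 'I_m}}) (creg : R) (N : nat) (tk : nat -> R)
    (kgs kgq : nat) (phih phil : 'rV[R]_4 -> R)
    (Theta : nat -> 'rV[R]_4 -> 'rV[R]_4) n :
  surface_neighborhood Omega T phi U ->
  discrete_surface Omega T U node mesh creg N tk kgs kgq phih phil Theta ->
  (1 <= n <= N)%N ->
  measurable (Sh_slab Omega node mesh tk phil Theta n : set (borel4 R)).
Proof.
move=> hU hd hn; rewrite /Sh_slab (Slin_QS hU (ds_QS hd hn)) image_bigcup.
rewrite bigcup_mkcond.
apply: (@countable_bigcupT_measurable _ (borel4 R) _ _ (countableP _)) => K.
case: ifPn => [|_]; last exact: measurable0.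
rewrite inE => cK.
apply: compact_measurable; exact: (compact_Theta_zero_prism hd hn cK).
Qed.

(** A Borel null superset of [B], cut down to the domain, has a Borel image whose measure is an
    integral over a null set. *)
Lemma negligible_image_vec3 (R : realType) (M : set 'rV[R]_4)
    (sigma : {measure set (borel4 R) -> \bar R}) (D : set 'rV[R]_3)
    (X : 'rV[R]_3 -> 'rV[R]_4) (B : set (R3 R)) :
  surface_measure M sigma -> parametrization M D X ->
  (leb3 R : {measure set (R3 R) -> \bar R}).-negligible B ->
  (forall y, B y -> D (vec3 y)) ->
  sigma.-negligible ((fun y => X (vec3 y)) @` B : set (borel4 R)).
Proof.
move=> hs hX [N [mN N0 BN]] BD; have [oD C1 iX _] := hX.
pose D' := (fun y : R3 R => vec3 y) @^-1` D.
have mD' : measurable D' by exact: vec3_open_measurable.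
have mND : measurable (N `&` D') by exact: measurableI.
have NDD y : (N `&` D') y -> D (vec3 y) by case.
have cX x : D x -> {for x, continuous X}.
  by move=> Dx; apply: differentiable_continuous; exact: C1.1.
exists ((fun y => X (vec3 y)) @` (N `&` D')); split.
- exact: image_vec3_measurable oD cX iX mND NDD.
- rewrite (surface_measure_param hs hX mND NDD); apply: null_set_integral => //.
    apply/measurable_EFinP; apply: (@measurable_funS _ _ _ _ D') => //.
    apply: (@measurable_fun_vec3_real R D (gram X)) => // x Dx.
    exact: gram_continuous oD C1 Dx.
  apply/eqP; rewrite eq_le measure_ge0 andbT -N0.
  by apply: le_measure; rewrite ?inE.
- by move=> _ [y By <-]; exists y => //; split; [exact: BN|exact: BD].
Qed.

Lemma ae_compl d (T : measurableType d) (R : realType)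
    (mu : {measure set T -> \bar R}) (P : T -> Prop) :
  {ae mu, forall x, P x} ->
  exists N : set T, mu.-negligible N /\ forall x, ~ N x -> P x.
Proof. by move=> aeP; exists (~` P); split=> // x /contrapT. Qed.

(** * The ratio of the surface measures *)

(* The patch [X] may run inside the image of a face of the prism, where [theta] and
   [q] describe the surface on one side only; it suffices that [X x] is
   approached within the image of the prism along each coordinate axis. *)
Lemma normal_orthogonal (R : realType) (Omega : set 'rV[R]_3) (T : R)
    (U : set 'rV[R]_4) m (node : 'I_m -> 'rV[R]_3)
    (mesh : {set {set 'I_m}}) (creg : R) (N : nat) (tk : nat -> R)
    (kgs kgq : nat) (phih phil : 'rV[R]_4 -> R)
    (Theta : nat -> 'rV[R]_4 -> 'rV[R]_4) n (X : 'rV[R]_3 -> 'rV[R]_4) x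
    (K : {set 'I_m}) (y : 'rV[R]_4) (q : 'rV[R]_4 -> R)
    (theta : 'rV[R]_4 -> 'rV[R]_4) (nu : 'rV[R]_4) :
  discrete_surface Omega T U node mesh creg N tk kgs kgq phih phil Theta ->
  (1 <= n <= N)%N -> cut_element node mesh tk phil n K ->
  differentiable X x -> zero_prism node tk phil n K y -> Theta n y = X x ->
  prism_extension (cylinder (simplex node K) (slab tk n)) phil y q ->
  prism_extension (cylinder (simplex node K) (slab tk n)) (Theta n) y theta ->
  grad q y != 0 -> 'J theta y \in unitmx ->
  (forall (j : 'I_3) (eps : R), 0 < eps -> exists r : R, [/\ r != 0, `|r| < eps &
     (Theta n @` zero_prism node tk phil n K) (X (x + r *: delta_mx 0 j))]) ->
  nu = normalize (normalize (grad q y) *m (invmx ('J theta y))^T) ->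
  enorm nu = 1 /\ 'J X x *m nu^T = 0.
Proof.
move=> hd hn cK dX zy yx [dq qE] [dth thE] gq0 Ju acc nuE.
have [_ _ homeo] := ds_Theta hd hn.
set v := grad q y *m (invmx ('J theta y))^T.
have vE : normalize (grad q y) *m (invmx ('J theta y))^T = (enorm (grad q y))^-1 *: v.
  by rewrite /normalize -scalemxAl.
have v0 : v != 0.
  apply: contra_neq gq0 => v0.
  have Jt : (invmx ('J theta y))^T \in unitmx by rewrite unitmx_tr unitmx_inv.
  by rewrite -(mulmxK Jt (grad q y)) -/v v0 mul0mx.
split.
  by rewrite nuE vE enorm_normalize// scaler_eq0 invr_eq0 enorm_eq0 negb_or gq0.
apply/row_matrixP => j; rewrite row0 rowE mulmxA mul_rV_jacobian mulmx_trE.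
rewrite dotC nuE vE /normalize !dotZl.
have -> : dot v ('d X x (delta_mx 0 j)) = 0.
  apply: (@tangent_orthogonal R 3 (QS node mesh tk phil n) (zero_prism node tk phil n K)
    (Theta n) theta q X x (delta_mx 0 j) y homeo) => //.
  - by move=> z [pz _]; exists K.
  - by move=> z [pz _]; exact: thE.
  - by move=> z [pz phi0]; rewrite qE.
  - move=> eps eps0; have [r [r0 re [z zz zX]]] := acc j eps eps0.
    by exists r; split => //; exists z.
by rewrite !mulr0 raddf0.
Qed.

(** Three kinds of points are discarded as null: those where the Gram identity for [mu] fails, those
    isolated along an axis in the part above some prism, and those excluded by the almost-everywhere
    statements on [nh]. At every other point of the patch [gram_closest] applies. *)
Lemma patch_ratio (R : realType)
  (Omega : set 'rV[R]_3) (T : R) (w : 'rV[R]_4 -> 'rV[R]_3)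
  (phi : 'rV[R]_4 -> R) (U : set 'rV[R]_4)
  (hsurf : evolving_surface Omega T w phi)
  (hU : surface_neighborhood Omega T phi U)
  (delta : 'rV[R]_4 -> R) (kappa : 'I_2 -> 'rV[R]_4 -> R)
  (hproj : projection_setting Omega T phi U delta kappa)
  (m : nat) (node : 'I_m -> 'rV[R]_3) (mesh : {set {set 'I_m}}) (creg : R)
  (N : nat) (tk : nat -> R) (kgs kgq : nat)
  (phih phil : 'rV[R]_4 -> R) (Theta : nat -> 'rV[R]_4 -> 'rV[R]_4)
  (hdisc : discrete_surface Omega T U node mesh creg N tk kgs kgq
             phih phil Theta)
  (sigma sigmah : {measure set (borel4 R) -> \bar R})
  (hsigma : surface_measure (surfS Omega T phi) sigma)
  (hsigmah : surface_measure (Sh Omega node mesh N tk phil Theta) sigmah)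
  (nh : 'rV[R]_4 -> 'rV[R]_4) (n : nat)
  (hnh : discrete_normal Omega node mesh tk phil Theta sigmah nh n)
  (hres : resolved Omega T phi U delta kappa node mesh tk phil Theta sigmah nh n)
  (hn : (1 <= n <= N)%N) (mu : 'rV[R]_4 -> R)
  (hmu : measure_ratio (Sh_slab Omega node mesh tk phil Theta n)
           (closest delta) sigma sigmah mu)
  (D : set 'rV[R]_3) (X : 'rV[R]_3 -> 'rV[R]_4) :
  parametrization (Sh_slab Omega node mesh tk phil Theta n) D X ->
  (forall y, D y -> 0 < gram X y) ->
  sigmah.-negligible [set z : borel4 R | (X @` D) z /\
    mu z != extension delta (alpha w phi) z * dot (nrm0 delta z) (nh z) *
           \prod_(i < 2) (1 - delta z * kappa i z)].
Proof.
move=> [oD C1X iX XM] gX0.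
have XMx x : D x -> Sh_slab Omega node mesh tk phil Theta n (X x).
  by move=> Dx; apply: XM; exists x.
have XUx x : D x -> U (X x) by move=> Dx; exact: (resolved_sub hres (XMx _ Dx)).
have pX : parametrization (Sh Omega node mesh N tk phil Theta) D X.
  by split=> // z /XM Mz; exists n.
have [V [oV UV C2]] := delta_smooth hproj.
have C1Y : Ck 1 D (closest delta \o X).
  have XV : X @` D `<=` V by move=> _ [x Dx <-]; exact/UV/XUx.
  exact: (Ck1_comp oD C1X (Ck1_closest oV C2) XV).
have pY : parametrization (surfS Omega T phi) D (closest delta \o X).
  split; [exact: oD|exact: C1Y| |].
  - move=> x x' xD x'D /= E; apply: iX => //; move: xD x'D; rewrite !inE => Dx Dx'.
    have [_ + _] := resolved_bij hres; apply=> //; rewrite inE; exact: XMx.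
  - by move=> _ [x Dx <-]; apply: (proj_to_S hproj); exact: XUx.
have cX x : D x -> {for x, continuous X}.
  by move=> Dx; apply: differentiable_continuous; exact: C1X.1.
pose F (y : R3 R) : borel4 R := X (vec3 y).
pose D' := (fun y : R3 R => vec3 y) @^-1` D.
have mD' : measurable D' by exact: vec3_open_measurable.
have mM : measurable (Sh_slab Omega node mesh tk phil Theta n : set (borel4 R)).
  exact: measurable_Sh_slab hU hdisc hn.
have mF B : measurable B -> B `<=` D' -> measurable (F @` B).
  by move=> mB BD; exact: image_vec3_measurable oD cX iX mB BD.
have mgX : measurable_fun D' (fun y => gram X (vec3 y)).
  apply: (@measurable_fun_vec3_real R D (gram X)) => // x Dx.
  exact: gram_continuous oD C1X Dx.
have mgY : measurable_fun D' (fun y => gram (closest delta \o X) (vec3 y)).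
  apply: (@measurable_fun_vec3_real R D (gram (closest delta \o X))) => // x Dx.
  exact: gram_continuous oD C1Y Dx.
have FM B : B `<=` D' -> F @` B `<=` Sh_slab Omega node mesh tk phil Theta n.
  by move=> BD _ [y By <-]; apply: XMx; exact: BD.
have mFun : measurable_fun D' F by exact: measurable_fun_vec3.
have Nmu : (leb3 R : {measure set (R3 R) -> \bar R}).-negligible
    [set y | D' y /\ mu (F y) * gram X (vec3 y) != gram (closest delta \o X) (vec3 y)].
  have mmuF : measurable_fun D' (mu \o F).
    exact: (measurable_comp mM (FM _ (@subset_refl _ D')) hmu.1 mFun).
  have mmu : measurable_fun (F @` D') mu.
    by apply: measurable_funS hmu.1 => //; exact: FM.
  have gpos y : D' y -> 0 < gram X (vec3 y) by exact: gX0.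
  apply: (measure0_neq_density (@leb3_sigma_finite R) mD' mF mgX mgY mmuF mmu gpos).
  move=> B mB BD; split; first exact: (surface_measure_param hsigmah pX mB BD).
  have := hmu.2 _ (mF _ mB BD) (FM _ BD); rewrite image_comp => <-.
  exact: (surface_measure_param hsigma pY mB BD).
(* For cut K this set is Borel, since the image of [zero_prism] is compact, so [negligible_isolated]
   discards the parameters in [NE K]. *)
pose E (K : {set 'I_m}) : set (R3 R) := D' `&` F @^-1` (Theta n @` zero_prism node tk phil n K).
pose NE K := [set y | [/\ cut_element node mesh tk phil n K, E K y &
   exists j : 'I_3, ~ (forall eps : R, 0 < eps ->
      exists r : R, [/\ r != 0, `|r| < eps & E K (shift3 j r y)])]].
have negE K : (leb3 R : {measure set (R3 R) -> \bar R}).-negligible (NE K).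
  have [cK|ncK] := pselect (cut_element node mesh tk phil n K); last first.
    by apply: (negligibleS _ (negligible_set0 _)) => y [].
  have mE : measurable (E K).
    apply: mFun => //; apply: compact_measurable.
    exact: compact_Theta_zero_prism hdisc hn cK.
  by apply: negligibleS (negligible_isolated mE) => y [].
have [A1 [negA1 hA1]] := ae_compl hnh.
have [A2 [negA2 hA2]] := ae_compl (resolved_normal hres).
apply: (@negligibleS _ _ _ _ (F @` [set y | D' y /\ mu (F y) * gram X (vec3 y) !=
     gram (closest delta \o X) (vec3 y)] `|` \bigcup_K (F @` NE K) `|` (A1 `|` A2)));
  last first.
  apply: negligibleU; last exact: negligibleU.
  apply: negligibleU.
    by apply: (negligible_image_vec3 hsigmah pX Nmu) => y [].
  apply: negligible_bigcup_countType => K.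
  by apply: (negligible_image_vec3 hsigmah pX (negE K)) => y [_ []].
move=> _ [[x Dx <-] neq]; apply: contrapT => /not_orP[/not_orP[nmu nE] /not_orP[nA1 nA2]].
have D'x : D' (unvec3 x) by rewrite /D' /= unvec3K.
have Fx : F (unvec3 x) = X x by rewrite /F unvec3K.
have muE : mu (X x) * gram X x = gram (closest delta \o X) x.
  apply: contrapT => /eqP h; apply: nmu; exists (unvec3 x); last exact: Fx.
  by split; [exact: D'x|rewrite Fx unvec3K; exact: h].
have B1 := hA1 _ nA1.
have B2 := hA2 _ nA2.
have [K [y [q [theta [cK [py ly] yX [hq hth] [gq Ju nuE]]]]]] := B1 (XMx _ Dx).
have n0nu := B2 (XMx _ Dx).
have zy : zero_prism node tk phil n K y by split => //; case: ly.
have EK : E K (unvec3 x) by split => //; rewrite /= Fx; exists y.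
have acc (j : 'I_3) (eps : R) : 0 < eps -> exists r : R, [/\ r != 0, `|r| < eps &
     (Theta n @` zero_prism node tk phil n K) (X (x + r *: delta_mx 0 j))].
  move=> eps0; apply: contrapT => nr; apply: nE; exists K => //; exists (unvec3 x) => //.
  split => //; exists j => /(_ eps eps0)[r [r0 re [_]]].
  by rewrite /F /= vec3_shift3 unvec3K => h; apply: nr; exists r.
have [nu1 Jnu] := normal_orthogonal hdisc hn cK (C1X.1 _ Dx) zy yX hq hth gq Ju acc nuE.
have := gram_closest hsurf hU hproj (C1X.1 _ Dx) (gX0 _ Dx) (XUx _ Dx)
  (fun i => resolved_curvature hres i (XMx _ Dx)) nu1 Jnu n0nu.
(* Dividing by the positive Gram factor of the regular patch leaves the pointwise formula. *)
rewrite -muE mulrC => /(mulfI (lt0r_neq0 (gX0 _ Dx))) h.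
by move: neq; rewrite h eqxx.
Qed.

Theorem lemma4p1 (R : realType)
  (Omega : set 'rV[R]_3) (T : R) (w : 'rV[R]_4 -> 'rV[R]_3)
  (phi : 'rV[R]_4 -> R) (U : set 'rV[R]_4)
  (hsurf : evolving_surface Omega T w phi)
  (hU : surface_neighborhood Omega T phi U)
  (delta : 'rV[R]_4 -> R) (kappa : 'I_2 -> 'rV[R]_4 -> R)
  (hproj : projection_setting Omega T phi U delta kappa)
  (m : nat) (node : 'I_m -> 'rV[R]_3) (mesh : {set {set 'I_m}}) (creg : R)
  (N : nat) (tk : nat -> R) (kgs kgq : nat)
  (phih phil : 'rV[R]_4 -> R) (Theta : nat -> 'rV[R]_4 -> 'rV[R]_4)
  (hdisc : discrete_surface Omega T U node mesh creg N tk kgs kgq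
             phih phil Theta)
  (sigma sigmah : {measure set (borel4 R) -> \bar R})
  (hsigma : surface_measure (surfS Omega T phi) sigma)
  (hsigmah : surface_measure (Sh Omega node mesh N tk phil Theta) sigmah)
  (nh : 'rV[R]_4 -> 'rV[R]_4)
  (hnh : forall n, (1 <= n <= N)%N ->
     discrete_normal Omega node mesh tk phil Theta sigmah nh n)
  (hres : forall n, (1 <= n <= N)%N ->
     resolved Omega T phi U delta kappa node mesh tk phil Theta sigmah nh n)
  (n : nat) (hn : (1 <= n <= N)%N)
  (mu : 'rV[R]_4 -> R)
  (hmu : measure_ratio (Sh_slab Omega node mesh tk phil Theta n)
           (closest delta) sigma sigmah mu) :
  {ae sigmah, forall z : borel4 R,
    Sh_slab Omega node mesh tk phil Theta n z ->
    mu z = extension delta (alpha w phi) z * dot (nrm0 delta z) (nh z) *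
           \prod_(i < 2) (1 - delta z * kappa i z)}.
Proof.
have [D [X [D2 [Z [pX gX hZ cover]]]]] := ds_piecewise_smooth hdisc hn.
pose rhs (z : 'rV[R]_4) := extension delta (alpha w phi) z * dot (nrm0 delta z) (nh z) *
  \prod_(i < 2) (1 - delta z * kappa i z).
have patch k : sigmah.-negligible [set z : borel4 R | (X k @` D k) z /\ mu z != rhs z].
  exact: (patch_ratio hsurf hU hproj hdisc hsigma hsigmah (hnh n hn) (hres n hn) hn
    hmu (pX k) (gX k)).
(* The two-dimensional pieces are Borel, as continuous images of open sets, and have measure zero,
   so no formula is required on them. *)
have ridge k : sigmah.-negligible (Z k @` D2 k : set (borel4 R)).
  have [oD2 C1Z] := hZ k; apply/negligibleP.
    apply: image_open_measurable => // x Dx.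
    by apply: differentiable_continuous; exact: C1Z.1.
  exact: (surface_measure_lower_dim hsigmah oD2 C1Z).
apply: negligibleS (negligibleU (negligible_bigcup patch) (negligible_bigcup ridge)).
move=> z /not_implyP[Mz /eqP neq].
have [[k _ Xz]|[k _ Zz]] := cover _ Mz; first by left; exists k.
by right; exists k.
Qed.
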